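(* A generic holomorphic quadratic self-map of $\mathbb{P}^2$ having an invariant line is completely determined, up to linear equivalence, by the multipliers at all of its fixed points. Precisely: there is a nonempty Zariski open subset $U\subset E^{(4)}$ such that if $f,g\in U$ have the same values of $(t_1,d_1,\dots,t_4,d_4)$ and the same unordered collection of pairs $\{(u_5,v_5),(u_6,v_6),(u_7,v_7)\}$, then $g=\phi\circ f\circ\phi^{-1}$ for some $\phi\in\operatorname{Aut}(\mathbb{P}^2,\ell)$ (respecting the markings).
   Context: Fix a line $\ell\subset\mathbb{P}^2$. $E^{(4)}$ is the variety of holomorphic quadratic self-maps $f$ of $\mathbb{P}^2$ with $f(\ell)\subset\ell$, all of whose fixed points are isolated and non-degenerate ($\det(\mathbf{I}-Df|_p)\neq0$), with the four fixed points off $\ell$ marked and ordered $p_1,\dots,p_4$; $p_5,p_6,p_7$ are the fixed points on $\ell$. $t_i,d_i$ ($i\le4$) are the trace and determinant of $\mathbf{I}-Df|_{p_i}$; for $j=5,6,7$, $u_j,v_j$ are the eigenvalues of $\mathbf{I}-Df|_{p_j}$, $u_j$ being the one tangent to $\ell$. $\operatorname{Aut}(\mathbb{P}^2,\ell)\subset\mathrm{PGL}(3,\mathbb{C})$ is the group of automorphisms preserving $\ell$. *)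

(* Defs.v *)
(* Quadratic self-maps of P^2 over an algebraically closed
   field C of characteristic 0 (a numClosedFieldType, standing in for the
   complex numbers). Points of P^2 are nonzero row vectors 'rV[C]_3 up to
   scaling; the fixed line is l = {x_2 = 0}. *)
From HB Require Import structures.
From mathcomp Require Import all_boot all_order all_algebra.
Set Implicit Arguments. Unset Strict Implicit. Unset Printing Implicit Defensive.
Import Order.TTheory GRing.Theory Num.Theory.
Local Open Scope ring_scope.

Section Defs.
Variable C : numClosedFieldType.

Definition i0 : 'I_3 := inord 0.
Definition i1 : 'I_3 := inord 1.
Definition i2 : 'I_3 := inord 2.

Definition co (x : 'rV[C]_3) (i : 'I_3) : C := x ord0 i.

Definition mpair (m : 'I_6) : nat * nat :=
  match val m with
  | 0 => (0, 0)%N | 1 => (1, 1)%N | 2 => (2, 2)%N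
  | 3 => (0, 1)%N | 4 => (0, 2)%N | _ => (1, 2)%N end.

Definition monomial (m : 'I_6) (x : 'rV[C]_3) : C :=
  co x (inord (mpair m).1) * co x (inord (mpair m).2).

Definition dmonomial (j : 'I_3) (m : 'I_6) (x : 'rV[C]_3) : C :=
  ((mpair m).1 == val j)%:R * co x (inord (mpair m).2)
  + ((mpair m).2 == val j)%:R * co x (inord (mpair m).1).

Definition qeval (Fc : 'M[C]_(3, 6)) (x : 'rV[C]_3) : 'rV[C]_3 :=
  \row_k \sum_(m < 6) Fc k m * monomial m x.

Definition JF (Fc : 'M[C]_(3, 6)) (x : 'rV[C]_3) : 'M[C]_3 :=
  \matrix_(i, j) \sum_(m < 6) Fc i m * dmonomial j m x.

Definition same_point (u v : 'rV[C]_3) : Prop :=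
  exists c : C, c != 0 /\ u = c *: v.

(* f is holomorphic (a morphism of P^2): no common nonzero zero *)
Definition holo (Fc : 'M[C]_(3, 6)) : Prop :=
  forall x, qeval Fc x = 0 -> x = 0.

Definition inv_line (Fc : 'M[C]_(3, 6)) : Prop :=
  forall x, co x i2 = 0 -> co (qeval Fc x) i2 = 0.

Definition is_fixed (Fc : 'M[C]_(3, 6)) (p : 'rV[C]_3) : Prop :=
  p != 0 /\ exists lam : C, qeval Fc p = lam *: p.

(* affine chart x_k = 1 used at p: first nonzero coordinate *)
Definition cidx (p : 'rV[C]_3) : 'I_3 :=
  if co p i0 != 0 then i0 else if co p i1 != 0 then i1 else i2.

(* Df|_p : Jacobian of f in the affine chart x_k = 1 (k = cidx p), with
   affine coordinates y_(lift k 0), y_(lift k 1); quotient rule applied to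
   F_i / F_k at the normalized representative q = p / p_k. *)
Definition Df (Fc : 'M[C]_(3, 6)) (p : 'rV[C]_3) : 'M[C]_2 :=
  let k := cidx p in
  let q := (co p k)^-1 *: p in
  let J := JF Fc q in
  let Fq := qeval Fc q in
  \matrix_(i, j)
    ((J (lift k i) (lift k j) * co Fq k - co Fq (lift k i) * J k (lift k j))
       / (co Fq k ^+ 2)).

Definition tI (Fc : 'M[C]_(3, 6)) (p : 'rV[C]_3) : C := \tr (1%:M - Df Fc p).
Definition dI (Fc : 'M[C]_(3, 6)) (p : 'rV[C]_3) : C := \det (1%:M - Df Fc p).

(* For p on l (p_2 = 0) the chart index k is 0 or 1, the affine coordinate
   y_(lift k 0) runs along l and y_(lift k 1) = y_2 is transverse; since
   f(l) c l, Df|_p is triangular and e_0 (tangent to l) is an eigenvector.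
   u = eigenvalue of I - Df|_p tangent to l, v = the other eigenvalue. *)
Definition uI (Fc : 'M[C]_(3, 6)) (p : 'rV[C]_3) : C := 1 - Df Fc p 0 0.
Definition vI (Fc : 'M[C]_(3, 6)) (p : 'rV[C]_3) : C := tI Fc p - uI Fc p.

(* The (lifted) variety E^(4): a map f with f(l) c l, all fixed points
   isolated (finitely many) and nondegenerate, with the fixed points off l
   marked and ordered as ps 0, ..., ps 3. *)
Definition inE4 (Fc : 'M[C]_(3, 6)) (ps : 'I_4 -> 'rV[C]_3) : Prop :=
  [/\ holo Fc, inv_line Fc,
      (exists s : seq 'rV[C]_3,
          forall p, is_fixed Fc p -> exists2 q, q \in s & same_point p q),
      (forall p, is_fixed Fc p -> dI Fc p != 0) &
      [/\ forall i, is_fixed Fc (ps i) /\ co (ps i) i2 != 0,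
          forall i j, same_point (ps i) (ps j) -> i = j &
          forall p, is_fixed Fc p -> co p i2 != 0 ->
            exists i, same_point p (ps i)]].

Definition line_fixed_enum (Fc : 'M[C]_(3, 6)) (a : 'I_3 -> 'rV[C]_3) : Prop :=
  [/\ forall j, is_fixed Fc (a j) /\ co (a j) i2 = 0,
      forall i j, same_point (a i) (a j) -> i = j &
      forall p, is_fixed Fc p -> co p i2 = 0 -> exists j, same_point p (a j)].

Definition same_line_mults (Fc Gc : 'M[C]_(3, 6)) : Prop :=
  exists a b : 'I_3 -> 'rV[C]_3,
    [/\ line_fixed_enum Fc a, line_fixed_enum Gc b &
        forall j, uI Fc (a j) = uI Gc (b j) /\ vI Fc (a j) = vI Gc (b j)].

Definition in_Aut_l (A : 'M[C]_3) : Prop :=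
  A \in unitmx /\ forall x : 'rV[C]_3, co x i2 = 0 -> co (x *m A) i2 = 0.

End Defs.

(* Polynomials in countably many variables, as syntax, for Zariski opens. *)
Inductive pterm (R : Type) : Type :=
| PVar of nat
| PConst of R
| PAdd of pterm R & pterm R
| PMul of pterm R & pterm R
| POpp of pterm R.

Fixpoint peval (R : pzRingType) (e : nat -> R) (t : pterm R) : R :=
  match t with
  | PVar n => e n
  | PConst c => c
  | PAdd t1 t2 => peval e t1 + peval e t2
  | PMul t1 t2 => peval e t1 * peval e t2
  | POpp t1 => - peval e t1
  end.

(* the 18 + 12 = 30 affine coordinates of a lifted point (Fc, ps) *)
Definition coords (C : numClosedFieldType) (Fc : 'M[C]_(3, 6))
    (ps : 'I_4 -> 'rV[C]_3) (n : nat) : C :=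
  if (n < 18)%N then Fc (inord (n %/ 6)) (inord (n %% 6))
  else if (n < 30)%N then co (ps (inord ((n - 18) %/ 3))) (inord ((n - 18) %% 3))
  else 0.

(* Main.v *)
(* Write f = id + X/L with L affine and X a quadratic vector field on the affine
   plane, vanishing at p1, ..., p4.  With l_i = L(p_i), the Euler-Jacobi relations
   for X read
     sum 1/(l_i d_i) = 0,  sum t_i/(l_i d_i) = 0,  sum 1/(l_i^2 d_i) = 0,
   so the multipliers leave two candidates for (l_i): the map's own and a second
   one, rational in it.  Either candidate determines p1, ..., p4 up to affine
   equivalence and the divergence of X, hence X up to one scalar parameter.  The
   fixed points on the line are the zeros of the binary cubic K(y) = y ^ X(y); if
   n is the zero on the line of the linear part of div X, or of L, then K(n),
   divided by the resultant of X on the line, is determined by the pairs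
   (u_j, v_j), and it is affine in the parameter.  With the right candidate this
   determines the parameter.  With the wrong one it gives two incompatible linear
   equations: generically so, as an explicit map with rational fixed points
   shows. *)
Require Import Defs.
From HB Require Import structures.
From mathcomp Require Import all_boot all_order all_algebra ring.
Set Implicit Arguments. Unset Strict Implicit. Unset Printing Implicit Defensive.
Import GRing.Theory Num.Theory.
Local Open Scope ring_scope.

(** * Coordinates and multipliers *)

Section LinearAlgebra.
Variable C : numClosedFieldType.
Implicit Types (x : 'rV[C]_3) (A : 'M[C]_3) (Fc Gc : 'M[C]_(3, 6)).

(** The obstacle is the second candidate. A conjugation preserving the line is affine off it, so
    maps are written in barycentric coordinates with respect to p1, p2, p3, scaled so that l_4 = 1.
    In the unknowns 1/l_i, i = 1, 2, 3, the Euler-Jacobi relations are then two linear equations and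
    a quadratic one. Since the map itself supplies one solution, the other is its image under an
    orthogonal reflection and no square root is extracted. Excluding it is thus the nonvanishing of
    a rational function of the coefficients and marked points, and a single map where this function
    is defined and nonzero gives the nonempty open set. The multipliers on the line enter through a
    frame: vectors v1, v2 and v3 = v1 + v2 over the three fixed points, with X(v_j) = k_j v_j. Put
    kap = k1 + k2 - k3 and tau = det(v1, v2). Up to sign, k_j and L(v_j) are kap times functions of
    (u_j, v_j), the second entry being the transverse multiplier. The resultant and the values K(n)
    then share the factor kap^4 / tau^2, which alone depends on the frame and cancels in their
    quotients. *)

Lemma val_i0 : val i0 = 0. Proof. exact: inordK. Qed.
Lemma val_i1 : val i1 = 1. Proof. exact: inordK. Qed.
Lemma val_i2 : val i2 = 2. Proof. exact: inordK. Qed.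

Lemma ord3_cases (i : 'I_3) : [\/ i = i0, i = i1 | i = i2].
Proof.
case: i => [[|[|[|//]]] hi]; [constructor 1|constructor 2|constructor 3];
  by apply: val_inj; rewrite /= inordK.
Qed.

Lemma sum_ord3 (V : nmodType) (f : 'I_3 -> V) : \sum_i f i = f i0 + f i1 + f i2.
Proof.
rewrite !big_ord_recr big_ord0 /= add0r.
by congr (f _ + f _ + f _); apply: val_inj; rewrite /= inordK.
Qed.

Lemma sum_ord6 (V : nmodType) (f : 'I_6 -> V) :
  \sum_m f m = f (inord 0) + f (inord 1) + f (inord 2) + f (inord 3)
               + f (inord 4) + f (inord 5).
Proof.
rewrite !big_ord_recr big_ord0 /= add0r.
by congr (f _ + f _ + f _ + f _ + f _ + f _); apply: val_inj; rewrite /= inordK.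
Qed.

Lemma lift_i0 : (lift i0 (0 : 'I_2) = i1) * (lift i0 (1 : 'I_2) = i2).
Proof. by split; apply: val_inj; rewrite /= /bump !inordK. Qed.
Lemma lift_i1 : (lift i1 (0 : 'I_2) = i0) * (lift i1 (1 : 'I_2) = i2).
Proof. by split; apply: val_inj; rewrite /= /bump !inordK. Qed.
Lemma lift_i2 : (lift i2 (0 : 'I_2) = i0) * (lift i2 (1 : 'I_2) = i1).
Proof. by split; apply: val_inj; rewrite /= /bump !inordK. Qed.

Lemma det_ord2 (R : comPzRingType) (B : 'M[R]_2) : \det B = B 0 0 * B 1 1 - B 0 1 * B 1 0.
Proof.
rewrite (expand_det_row _ 0) !big_ord_recl big_ord0 /cofactor !det_mx11 !mxE /=.
rewrite expr0 expr1 mul1r mulN1r addr0 mulrN.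
by congr (B _ _ * B _ _ - B _ _ * B _ _); apply: val_inj.
Qed.

Lemma det_ord3 A :
  \det A = A i0 i0 * (A i1 i1 * A i2 i2 - A i1 i2 * A i2 i1)
         - A i0 i1 * (A i1 i0 * A i2 i2 - A i1 i2 * A i2 i0)
         + A i0 i2 * (A i1 i0 * A i2 i1 - A i1 i1 * A i2 i0).
Proof.
rewrite (expand_det_row _ i0) sum_ord3 /cofactor !det_ord2 !mxE.
by rewrite !lift_i0 !lift_i1 !lift_i2 val_i0 val_i1 val_i2; ring.
Qed.

Definition r3 (x y z : C) : 'rV[C]_3 := \row_i [:: x; y; z]`_i.

Lemma co_r3 (x y z : C) :
  (co (r3 x y z) i0 = x) * (co (r3 x y z) i1 = y) * (co (r3 x y z) i2 = z).
Proof. by rewrite /co /r3 !mxE val_i0 val_i1 val_i2. Qed.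

Lemma rv3P (u v : 'rV[C]_3) :
  co u i0 = co v i0 -> co u i1 = co v i1 -> co u i2 = co v i2 -> u = v.
Proof.
by move=> h0 h1 h2; apply/rowP=> i; case: (ord3_cases i) => ->.
Qed.

Lemma r3E x : x = r3 (co x i0) (co x i1) (co x i2).
Proof. by apply: rv3P; rewrite co_r3. Qed.

Lemma co_scale c x i : co (c *: x) i = c * co x i.
Proof. by rewrite /co mxE. Qed.

Lemma co_add x y i : co (x + y) i = co x i + co y i.
Proof. by rewrite /co mxE. Qed.

Lemma co_mulmx x A k : co (x *m A) k = co x i0 * A i0 k + co x i1 * A i1 k + co x i2 * A i2 k.
Proof. by rewrite /co mxE sum_ord3. Qed.

Lemma co0 i : co (0 : 'rV[C]_3) i = 0.
Proof. by rewrite /co mxE. Qed.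

Lemma co_qeval Fc x k :
  co (qeval Fc x) k =
    Fc k (inord 0) * co x i0 ^+ 2 + Fc k (inord 1) * co x i1 ^+ 2
  + Fc k (inord 2) * co x i2 ^+ 2 + Fc k (inord 3) * (co x i0 * co x i1)
  + Fc k (inord 4) * (co x i0 * co x i2) + Fc k (inord 5) * (co x i1 * co x i2).
Proof.
by rewrite {1}/co mxE sum_ord6 /monomial /mpair /= !inordK // -!expr2.
Qed.

Lemma JF_E Fc x k :
  (JF Fc x k i0 = 2%:R * Fc k (inord 0) * co x i0 + Fc k (inord 3) * co x i1
                  + Fc k (inord 4) * co x i2)
* (JF Fc x k i1 = 2%:R * Fc k (inord 1) * co x i1 + Fc k (inord 3) * co x i0
                  + Fc k (inord 5) * co x i2)
* (JF Fc x k i2 = 2%:R * Fc k (inord 2) * co x i2 + Fc k (inord 4) * co x i0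
                  + Fc k (inord 5) * co x i1).
Proof.
by rewrite !mxE !sum_ord6 /dmonomial /mpair /= !inordK //= -/i0 -/i1 -/i2;
  split; [split|]; ring.
Qed.

Lemma qeval_scale Fc c x : qeval Fc (c *: x) = c ^+ 2 *: qeval Fc x.
Proof. by apply: rv3P; rewrite co_scale !co_qeval !co_scale; ring. Qed.

Lemma JF_scale Fc c x : JF Fc (c *: x) = c *: JF Fc x.
Proof.
by apply/matrixP=> i j; rewrite [RHS]mxE; case: (ord3_cases j) => ->;
  rewrite !JF_E !co_scale; ring.
Qed.

Lemma co_mul_JF Fc h x k :
  co (h *m (JF Fc x)^T) k = JF Fc x k i0 * co h i0 + JF Fc x k i1 * co h i1 + JF Fc x k i2 * co h i2.
Proof. by rewrite co_mulmx ![_^T _ _]mxE ![co h _ * _]mulrC. Qed.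

Lemma qeval_polarization Fc x h :
  qeval Fc (x + h) = qeval Fc x + qeval Fc h + h *m (JF Fc x)^T.
Proof.
by apply: rv3P; rewrite !co_add co_mul_JF !co_qeval !co_add !JF_E; ring.
Qed.

Lemma euler_JF Fc x k :
  JF Fc x k i0 * co x i0 + JF Fc x k i1 * co x i1 + JF Fc x k i2 * co x i2
  = 2%:R * co (qeval Fc x) k.
Proof. by rewrite co_qeval !JF_E; ring. Qed.

End LinearAlgebra.

(** * Multipliers at fixed points from the homogeneous Jacobian *)

Section Multipliers.
Variable C : numClosedFieldType.
Implicit Types (x p : 'rV[C]_3) (A : 'M[C]_3) (Fc Gc : 'M[C]_(3, 6)).

Lemma tr_ord2 (B : 'M[C]_2) : \tr B = B 0 0 + B 1 1.
Proof.
by rewrite /mxtrace !big_ord_recl big_ord0 addr0; congr (B _ _ + B _ _); apply: val_inj.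
Qed.

Lemma tr_ord3 A : \tr A = A i0 i0 + A i1 i1 + A i2 i2.
Proof. by rewrite /mxtrace sum_ord3. Qed.

Lemma cidx_cases p : p != 0 ->
  [\/ cidx p = i0 /\ co p i0 != 0, cidx p = i1 /\ co p i1 != 0
    | cidx p = i2 /\ co p i2 != 0].
Proof.
rewrite /cidx => p0.
case: eqP => h0; last by constructor 1; split=> //; apply/eqP.
case: eqP => h1; last by constructor 2; split=> //; apply/eqP.
constructor 3; split=> //; apply: contra_neq p0 => h2.
by apply: rv3P; rewrite co0.
Qed.

Lemma ord3_eqF : (((i0 == i1) = false) * ((i0 == i2) = false) * ((i1 == i2) = false)
  * ((i1 == i0) = false) * ((i2 == i0) = false) * ((i2 == i1) = false))%type.
Proof. by do !split; rewrite -val_eqE /= !inordK. Qed.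

(** The chart coordinate is put first, so that one identity serves all three charts. Euler's
    relations express the first column of the Jacobian through the other two, and a rational
    identity remains. *)
Lemma affine_chart_multipliers (m jkk jka jkb jak jaa jab jbk jba jbb y z : C) :
  m != 0 -> jkk + jka * y + jkb * z = 2%:R * m ->
  jak + jaa * y + jab * z = 2%:R * (m * y) ->
  jbk + jba * y + jbb * z = 2%:R * (m * z) ->
  let D00 := (jaa * m - m * y * jka) / m ^+ 2 in
  let D01 := (jab * m - m * y * jkb) / m ^+ 2 in
  let D10 := (jba * m - m * z * jka) / m ^+ 2 in
  let D11 := (jbb * m - m * z * jkb) / m ^+ 2 in
  (1 - D00) + (1 - D11) = 4%:R - (jkk + jaa + jbb) / m /\
  (1 - D00) * (1 - D11) - (0 - D01) * (0 - D10) =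
  - ((1 - m^-1 * jkk) * ((1 - m^-1 * jaa) * (1 - m^-1 * jbb)
                         - (0 - m^-1 * jab) * (0 - m^-1 * jba))
     - (0 - m^-1 * jka) * ((0 - m^-1 * jak) * (1 - m^-1 * jbb)
                         - (0 - m^-1 * jab) * (0 - m^-1 * jbk))
     + (0 - m^-1 * jkb) * ((0 - m^-1 * jak) * (0 - m^-1 * jba)
                         - (1 - m^-1 * jaa) * (0 - m^-1 * jbk))).
Proof.
move=> m0 e0 e1 e2 /=.
have {e0} -> : jkk = 2%:R * m - jka * y - jkb * z by rewrite -e0; ring.
have {e1} -> : jak = 2%:R * (m * y) - jaa * y - jab * z by rewrite -e1; ring.
have {e2} -> : jbk = 2%:R * (m * z) - jba * y - jbb * z by rewrite -e2; ring.
by split; field.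
Qed.

Lemma sub1mxE n (B : 'M[C]_n) i j : (1%:M - B) i j = (i == j)%:R - B i j.
Proof. by rewrite [LHS]mxE [X in X + _]mxE [X in _ + X]mxE. Qed.

Lemma DfE Fc p k i j : cidx p = k -> let q := (co p k)^-1 *: p in
  Df Fc p i j = (JF Fc q (lift k i) (lift k j) * co (qeval Fc q) k
    - co (qeval Fc q) (lift k i) * JF Fc q k (lift k j)) / co (qeval Fc q) k ^+ 2.
Proof. by move=> <-; rewrite mxE. Qed.

(** The Jacobian and the eigenvalue both have degree 1 in the representative, so their quotient
    allows passing to the representative with [k]-th coordinate 1, on which [Df] is defined. *)
Lemma fixed_normalized Fc p lam k : co p k != 0 -> lam != 0 ->
  qeval Fc p = lam *: p -> let q := (co p k)^-1 *: p in
  exists2 m, [/\ m != 0, co q k = 1 & qeval Fc q = m *: q]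
     & \tr (JF Fc p) / lam = \tr (JF Fc q) / m /\
       lam^-1 *: JF Fc p = m^-1 *: JF Fc q.
Proof.
move=> pk lam0 fp q.
have -> : JF Fc p = co p k *: JF Fc q by rewrite -JF_scale scalerA divff ?scale1r.
exists (lam / co p k).
  split; first by rewrite mulf_neq0 ?invr_eq0.
    by rewrite co_scale mulVf.
  by rewrite qeval_scale fp !scalerA; congr (_ *: _); field.
rewrite mxtraceZ scalerA; split; first by field; rewrite lam0 pk.
by congr (_ *: _); field; rewrite lam0 pk.
Qed.

(* By Euler's relation [JF p] acts on the line through [p] as [2 lam], and as
   [lam Df] on the quotient, which is the tangent space at [p]. *)
Lemma fixed_tI_dI Fc p lam : p != 0 -> lam != 0 -> qeval Fc p = lam *: p ->
  tI Fc p = 4%:R - \tr (JF Fc p) / lam /\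
  dI Fc p = - \det (1%:M - lam^-1 *: JF Fc p).
Proof.
move=> p0 lam0 fp.
rewrite /tI /dI tr_ord2 det_ord2 det_ord3 tr_ord3.
have scE (c : C) (B : 'M[C]_3) i j : (c *: B) i j = c * B i j by rewrite mxE.
have [|[ck pk]|[ck pk]|[ck pk]] := @cidx_cases p => //;
  have [m [m0 qk fq] []] := fixed_normalized pk lam0 fp;
  rewrite !sub1mxE !(DfE _ _ _ ck) /=;
  move: qk fq; set q := _ *: p => qk fq;
  have := (euler_JF Fc q i0, euler_JF Fc q i1, euler_JF Fc q i2);
  rewrite !tr_ord3 !ord3_eqF !eqxx /= ?lift_i0 ?lift_i1 ?lift_i2 fq;
  rewrite !(co_scale _ q) qk !mulr1 => -[[e0 e1] e2] -> ->; rewrite !scE.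
- have [-> ->] := affine_chart_multipliers m0 e0 e1 e2; split; ring.
- have e1' : JF Fc q i1 i1 + JF Fc q i1 i0 * co q i0 + JF Fc q i1 i2 * co q i2 = 2%:R * m.
    by rewrite -e1; ring.
  have e0' : JF Fc q i0 i1 + JF Fc q i0 i0 * co q i0 + JF Fc q i0 i2 * co q i2 = 2%:R * (m * co q i0).
    by rewrite -e0; ring.
  have e2' : JF Fc q i2 i1 + JF Fc q i2 i0 * co q i0 + JF Fc q i2 i2 * co q i2 = 2%:R * (m * co q i2).
    by rewrite -e2; ring.
  have [-> ->] := affine_chart_multipliers m0 e1' e0' e2'; split; ring.
- have e2' : JF Fc q i2 i2 + JF Fc q i2 i0 * co q i0 + JF Fc q i2 i1 * co q i1 = 2%:R * m.
    by rewrite -e2; ring.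
  have e0' : JF Fc q i0 i2 + JF Fc q i0 i0 * co q i0 + JF Fc q i0 i1 * co q i1 = 2%:R * (m * co q i0).
    by rewrite -e0; ring.
  have e1' : JF Fc q i1 i2 + JF Fc q i1 i0 * co q i0 + JF Fc q i1 i1 * co q i1 = 2%:R * (m * co q i1).
    by rewrite -e1; ring.
  have [-> ->] := affine_chart_multipliers m0 e2' e0' e1'; split; ring.
Qed.

Lemma inv_line_coef Fc : inv_line Fc ->
  [/\ Fc i2 (inord 0) = 0, Fc i2 (inord 1) = 0 & Fc i2 (inord 3) = 0].
Proof.
move=> Fl.
have e (x y : C) : Fc i2 (inord 0) * x ^+ 2 + Fc i2 (inord 1) * y ^+ 2 + Fc i2 (inord 3) * (x * y) = 0.
  by have := Fl (r3 x y 0); rewrite co_qeval !co_r3 => /(_ erefl) <-; ring.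
have e0 : Fc i2 (inord 0) = 0 by rewrite -(e 1 0); ring.
have e1 : Fc i2 (inord 1) = 0 by rewrite -(e 0 1); ring.
by split=> //; rewrite -(e 1 1) e0 e1; ring.
Qed.

Lemma JF_line Fc p : inv_line Fc -> co p i2 = 0 ->
  JF Fc p i2 i0 = 0 /\ JF Fc p i2 i1 = 0.
Proof. by move=> /inv_line_coef [a b c] p2; rewrite !JF_E p2 a b c; split; ring. Qed.

(** On the line the third row of the Jacobian has only its last entry, and the chart has index 0 or
    1; so [Df] is triangular there, with the transverse coordinate second. *)
Lemma line_fixed_vI Fc p lam : inv_line Fc -> p != 0 -> lam != 0 ->
  qeval Fc p = lam *: p -> co p i2 = 0 ->
  vI Fc p = 1 - JF Fc p i2 i2 / lam /\ dI Fc p = uI Fc p * vI Fc p.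
Proof.
move=> Fl p0 lam0 fp p2.
have entry (c d : C) (B D : 'M[C]_3) i j : c *: B = d *: D -> c * B i j = d * D i j.
  by move=> /matrixP /(_ i j); rewrite !mxE.
rewrite /dI /vI /tI /uI tr_ord2 det_ord2 !sub1mxE /=.
have [|[ck pk]|[ck pk]|[ck pk]] := @cidx_cases p => //; last by rewrite p2 eqxx in pk.
all: have [m [m0 qk fq] [_ Jq]] := fixed_normalized pk lam0 fp.
all: have q2 : co ((co p (cidx p))^-1 *: p) i2 = 0 by rewrite co_scale p2 mulr0.
all: have [J0 J1] := JF_line Fl q2.
all: rewrite [_ / lam]mulrC (entry _ _ _ _ _ _ Jq) !(DfE _ _ _ ck) /= ck in q2 J0 J1 *.
all: move: qk fq q2 J0 J1; set q := _ *: p => qk fq q2 J0 J1.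
all: rewrite ?lift_i0 ?lift_i1 ?J0 ?J1 fq !(co_scale _ q) qk q2.
all: by split; field.
Qed.

Lemma holo_eigen_neq0 Fc p lam : holo Fc -> p != 0 -> qeval Fc p = lam *: p -> lam != 0.
Proof.
move=> Fh p0 fp; apply: contra_neq p0 => l0; apply: Fh.
by rewrite fp l0 scale0r.
Qed.

End Multipliers.

(** * Linear conjugation and the invariance of the multipliers *)

Section Conjugation.
Variable C : numClosedFieldType.
Implicit Types (x p : 'rV[C]_3) (A : 'M[C]_3) (F G : 'M[C]_(3, 6)) (c lam : C).

(** [G] is [F] read in the coordinates [x] of the point [x *m A]. The scalar [c] is kept because a
    coefficient matrix represents a map of the plane only up to scale. *)
Definition conjugates c A F G : Prop :=
  [/\ c != 0, A \in unitmx
    & forall x, qeval F (x *m A) = c *: (qeval G x *m A)].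

Definition preserves_line A : Prop := [/\ A i0 i2 = 0, A i1 i2 = 0 & A i2 i2 != 0].

(** This chain rule is the bilinear part of the conjugacy at [x + h]: after polarizing both sides,
    the terms in [x] alone and in [h] alone cancel. *)
Lemma conjugates_JF c A F G x : conjugates c A F G ->
  A *m (JF F (x *m A))^T = c *: ((JF G x)^T *m A).
Proof.
case=> _ _ FG; apply/row_matrixP=> i; rewrite !rowE; set h := delta_mx _ _.
have := qeval_polarization F (x *m A) (h *m A).
rewrite -mulmxDl !FG qeval_polarization !mulmxDl !scalerDr => /addrI.
by rewrite mulmxA -scalemxAr mulmxA.
Qed.

Lemma mulmx_unit_eq0 A x : A \in unitmx -> (x *m A == 0) = (x == 0).
Proof.
move=> uA; apply/eqP/eqP=> [xA|->]; last by rewrite mul0mx.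
by rewrite -[x](mulmxK uA) xA mul0mx.
Qed.

Lemma conjugates_eigen c A F G x lam : conjugates c A F G ->
  qeval G x = lam *: x -> qeval F (x *m A) = (c * lam) *: (x *m A).
Proof. by case=> _ _ FG Gx; rewrite FG Gx -scalemxAl scalerA. Qed.

Lemma conjugates_sym c A F G : conjugates c A F G ->
  conjugates c^-1 (invmx A) G F.
Proof.
case=> c0 uA FG; split=> [||x]; rewrite ?invr_eq0 ?unitmx_inv //.
have := FG (x *m invmx A); rewrite mulmxKV // => ->.
by rewrite -scalemxAl mulmxK // scalerA mulVf ?scale1r.
Qed.

Lemma conjugates_fixed c A F G x : conjugates c A F G ->
  is_fixed G x -> is_fixed F (x *m A).
Proof.
move=> FG [x0 [lam Gx]]; case: (FG) => _ uA _; split; first by rewrite mulmx_unit_eq0.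
by exists (c * lam); apply: conjugates_eigen FG Gx.
Qed.

Lemma conjugates_holo c A F G : conjugates c A F G -> holo F -> holo G.
Proof.
case=> c0 uA FG hF x Gx; apply/eqP; rewrite -(mulmx_unit_eq0 _ uA); apply/eqP/hF.
by rewrite FG Gx mul0mx scaler0.
Qed.

Lemma conjugates_tI_dI c A F G x : conjugates c A F G -> holo F -> is_fixed G x ->
  tI F (x *m A) = tI G x /\ dI F (x *m A) = dI G x.
Proof.
move=> FG hF [x0 [lam Gx]]; have hG := conjugates_holo FG hF.
have lam0 := holo_eigen_neq0 hG x0 Gx; case: (FG) => c0 uA _.
have xA0 : x *m A != 0 by rewrite mulmx_unit_eq0.
have Fx := conjugates_eigen FG Gx.
have cl0 : c * lam != 0 by rewrite mulf_neq0.
have [-> ->] := fixed_tI_dI xA0 cl0 Fx; have [-> ->] := fixed_tI_dI x0 lam0 Gx.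
(* The transposed Jacobians are similar up to the factor [c], which the eigenvalue [c * lam]
   absorbs. *)
have JE : (JF F (x *m A))^T = c *: (invmx A *m (JF G x)^T *m A).
  by rewrite -[LHS](mulKmx uA) (conjugates_JF _ FG) -scalemxAr mulmxA.
split.
  rewrite -[in LHS]mxtrace_tr JE mxtraceZ mxtrace_mulC mulmxA mulmxV // mul1mx mxtrace_tr.
  by rewrite -mulf_div divff ?mul1r.
have trE k (M : 'M[C]_3) : (1%:M - k *: M)^T = 1%:M - k *: M^T.
  by rewrite linearB /= linearZ /= trmx1.
congr (- _); rewrite -[in LHS]det_tr -[in RHS]det_tr !trE JE.
have -> : 1%:M - (c * lam)^-1 *: (c *: (invmx A *m (JF G x)^T *m A))
  = invmx A *m (1%:M - lam^-1 *: (JF G x)^T) *m A.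
  rewrite mulmxBr mulmx1 mulmxBl mulVmx // scalerA -scalemxAr -scalemxAl.
  by congr (_ - _ *: _); field; rewrite lam0.
by rewrite !det_mulmx mulrAC -det_mulmx mulVmx // det1 mul1r.
Qed.

Lemma preserves_line_co A x : preserves_line A -> co (x *m A) i2 = co x i2 * A i2 i2.
Proof. by case=> a b _; rewrite co_mulmx a b; ring. Qed.

Lemma preserves_line_inv A : A \in unitmx -> preserves_line A -> preserves_line (invmx A).
Proof.
move=> uA pA; case: (pA) => _ _ A22.
have e i : co (row i (invmx A)) i2 * A i2 i2 = (i == i2)%:R.
  rewrite -preserves_line_co // -row_mul mulVmx // /co mxE.
  by rewrite mxE.
have d i : invmx A i i2 = (i == i2)%:R / A i2 i2.
  by rewrite -e /co mxE mulfK.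
by split; rewrite d ?ord3_eqF ?eqxx ?mul0r // mul1r invr_eq0.
Qed.

Lemma preserves_line_in_Aut A : A \in unitmx -> preserves_line A -> in_Aut_l A.
Proof. by move=> uA pA; split=> // x x2; rewrite preserves_line_co // x2 mul0r. Qed.

Lemma preserves_line_mul A A' : preserves_line A -> preserves_line A' -> preserves_line (A *m A').
Proof.
move=> [a b c] [a' b' c']; split; rewrite !mxE !sum_ord3 ?a ?b ?a' ?b' ?c ?c' ?mulr0 ?mul0r ?addr0 //.
by rewrite add0r mulf_neq0.
Qed.

Lemma conjugates_inv_line c A F G : conjugates c A F G -> preserves_line A ->
  inv_line F -> inv_line G.
Proof.
move=> [c0 uA FG] pA Fl x x2; have [_ _ A22] := pA.
have := Fl (x *m A); rewrite preserves_line_co // x2 mul0r => /(_ erefl).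
rewrite FG co_scale preserves_line_co // => /eqP.
by rewrite !mulf_eq0 (negPf c0) (negPf A22) orbF => /eqP.
Qed.

Lemma conjugates_uI_vI c A F G x : conjugates c A F G -> preserves_line A ->
  holo F -> inv_line F -> is_fixed G x -> co x i2 = 0 ->
  uI F (x *m A) = uI G x /\ vI F (x *m A) = vI G x.
Proof.
move=> FG pA hF Fl fx x2; have [x0 [lam Gx]] := fx; have hG := conjugates_holo FG hF.
have lam0 := holo_eigen_neq0 hG x0 Gx; have [c0 uA _] := FG.
have Gl := conjugates_inv_line FG pA Fl.
have xA0 : x *m A != 0 by rewrite mulmx_unit_eq0.
have Fx := conjugates_eigen FG Gx.
have cl0 : c * lam != 0 by rewrite mulf_neq0.
have xA2 : co (x *m A) i2 = 0 by rewrite preserves_line_co // x2 mul0r.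
have [tE _] := conjugates_tI_dI FG hF fx.
(* The chart in which [uI] is read may change under [A]. The formula of [line_fixed_vI] for [vI]
   does not depend on it, and [uI] follows from the trace. *)
suff vE : vI F (x *m A) = vI G x.
  by split=> //; move: vE tE; rewrite /vI => vE tE; rewrite tE in vE;
    move/addrI/oppr_inj: vE.
have [-> _] := line_fixed_vI Fl xA0 cl0 Fx xA2; have [-> _] := line_fixed_vI Gl x0 lam0 Gx x2.
have [J0 J1] := JF_line Fl xA2; have [a b A22] := pA.
have -> : JF F (x *m A) i2 i2 = c * JF G x i2 i2.
  apply: (mulfI A22); have /matrixP/(_ i2 i2) := conjugates_JF x FG.
  rewrite [LHS]mxE [RHS]mxE [X in c * X]mxE !sum_ord3 ![_^T _ _]mxE.
  by rewrite J0 J1 a b !mulr0 !add0r => ->; ring.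
by rewrite -mulf_div divff ?mul1r.
Qed.

Lemma conjugates_line_enum c A F G (a : 'I_3 -> 'rV[C]_3) :
  conjugates c A F G -> preserves_line A -> line_fixed_enum F a ->
  line_fixed_enum G (fun j => a j *m invmx A).
Proof.
move=> FG pA [a1 a2 a3]; have [c0 uA _] := FG.
have sFG := conjugates_sym FG; have pA' := preserves_line_inv uA pA.
split=> [j|i j [k [k0 e]]|p fp p2].
- have [fa a20] := a1 j; split; first exact: conjugates_fixed sFG fa.
  by rewrite preserves_line_co // a20 mul0r.
- apply: a2; exists k; split=> //.
  by rewrite -[a i](mulmxKV uA) e -scalemxAl mulmxKV.
- have [||j [k [k0 e]]] := a3 (p *m A); first exact: conjugates_fixed FG fp.
    by rewrite preserves_line_co // p2 mul0r.
  by exists j, k; split=> //; rewrite scalemxAl -e mulmxK.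
Qed.

End Conjugation.

(** * The reflection exchanging the two solutions of the Euler-Jacobi relations *)

Section Reflection.
Variable C : numClosedFieldType.

(* The two linear equations cut out a line in the space of [(m1, m2, m3)], of
   direction [(d1 th1, d2 th2, d3 th3)]; the quadric meets it in two points. *)
Lemma line_quadric_roots (t1 t2 t3 d1 d2 d3 c1 c2 c3 m1 m2 m3 n1 n2 n3 : C) :
  let th1 := t2 - t3 in let th2 := t3 - t1 in let th3 := t1 - t2 in
  let Th := d1 * th1 ^+ 2 + d2 * th2 ^+ 2 + d3 * th3 ^+ 2 in
  let Y := m1 * th1 + m2 * th2 + m3 * th3 in
  d1 != 0 -> d2 != 0 -> d3 != 0 -> Th != 0 ->
  m1 / d1 + m2 / d2 + m3 / d3 = c1 -> n1 / d1 + n2 / d2 + n3 / d3 = c1 ->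
  t1 * m1 / d1 + t2 * m2 / d2 + t3 * m3 / d3 = c2 ->
  t1 * n1 / d1 + t2 * n2 / d2 + t3 * n3 / d3 = c2 ->
  m1 ^+ 2 / d1 + m2 ^+ 2 / d2 + m3 ^+ 2 / d3 = c3 ->
  n1 ^+ 2 / d1 + n2 ^+ 2 / d2 + n3 ^+ 2 / d3 = c3 ->
  [/\ n1 = m1, n2 = m2 & n3 = m3] \/
  [/\ n1 = m1 - 2%:R * Y * d1 * th1 / Th, n2 = m2 - 2%:R * Y * d2 * th2 / Th
    & n3 = m3 - 2%:R * Y * d3 * th3 / Th].
Proof.
move=> th1 th2 th3 Th Y d10 d20 d30 Th0 e1 e1' e2 e2' e3 e3'.
pose h1 := (m1 - n1) / d1; pose h2 := (m2 - n2) / d2; pose h3 := (m3 - n3) / d3.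
have s0 : h1 + h2 + h3 = 0.
  apply: etrans (_ : (m1 / d1 + m2 / d2 + m3 / d3) - (n1 / d1 + n2 / d2 + n3 / d3) = _).
    by rewrite /h1 /h2 /h3; ring.
  by rewrite e1 e1' subrr.
have s1 : t1 * h1 + t2 * h2 + t3 * h3 = 0.
  apply: etrans (_ : (t1 * m1 / d1 + t2 * m2 / d2 + t3 * m3 / d3)
     - (t1 * n1 / d1 + t2 * n2 / d2 + t3 * n3 / d3) = _).
    by rewrite /h1 /h2 /h3; ring.
  by rewrite e2 e2' subrr.
(* [h] is orthogonal to (1, 1, 1) and to (t1, t2, t3), hence proportional to their cross product
   (th1, th2, th3). Pairing with (d_i th_i) gives the factor [Z / Th]. *)
have p12 : h1 * th2 = h2 * th1.
  apply/eqP; rewrite -subr_eq0; apply/eqP.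
  apply: etrans (_ : t3 * (h1 + h2 + h3) - (t1 * h1 + t2 * h2 + t3 * h3) = _).
    by rewrite /th1 /th2; ring.
  by rewrite s0 s1; ring.
have p13 : h1 * th3 = h3 * th1.
  apply/eqP; rewrite -subr_eq0; apply/eqP.
  apply: etrans (_ : (t1 * h1 + t2 * h2 + t3 * h3) - t2 * (h1 + h2 + h3) = _).
    by rewrite /th1 /th3; ring.
  by rewrite s0 s1; ring.
have p23 : h2 * th3 = h3 * th2.
  apply/eqP; rewrite -subr_eq0; apply/eqP.
  apply: etrans (_ : t1 * (h1 + h2 + h3) - (t1 * h1 + t2 * h2 + t3 * h3) = _).
    by rewrite /th2 /th3; ring.
  by rewrite s0 s1; ring.
pose Z := d1 * h1 * th1 + d2 * h2 * th2 + d3 * h3 * th3.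
have g1 : h1 = Z / Th * th1.
  apply: (mulIf Th0); apply: etrans (_ : Z * th1 = _); last by field.
  rewrite /Th /Z; apply/eqP; rewrite -subr_eq0; apply/eqP.
  apply: etrans (_ : d2 * th2 * (h1 * th2 - h2 * th1) + d3 * th3 * (h1 * th3 - h3 * th1) = _).
    by ring.
  by rewrite p12 p13; ring.
have g2 : h2 = Z / Th * th2.
  apply: (mulIf Th0); apply: etrans (_ : Z * th2 = _); last by field.
  rewrite /Th /Z; apply/eqP; rewrite -subr_eq0; apply/eqP.
  apply: etrans (_ : d1 * th1 * (h2 * th1 - h1 * th2) + d3 * th3 * (h2 * th3 - h3 * th2) = _).
    by ring.
  by rewrite p12 p23; ring.
have g3 : h3 = Z / Th * th3.
  apply: (mulIf Th0); apply: etrans (_ : Z * th3 = _); last by field.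
  rewrite /Th /Z; apply/eqP; rewrite -subr_eq0; apply/eqP.
  apply: etrans (_ : d1 * th1 * (h3 * th1 - h1 * th3) + d2 * th2 * (h3 * th2 - h2 * th3) = _).
    by ring.
  by rewrite p13 p23; ring.
have n1E : n1 = m1 - d1 * h1 by rewrite /h1; field.
have n2E : n2 = m2 - d2 * h2 by rewrite /h2; field.
have n3E : n3 = m3 - d3 * h3 by rewrite /h3; field.
have ZY : Z = Y - (n1 * th1 + n2 * th2 + n3 * th3).
  by rewrite n1E n2E n3E /Z /Y; ring.
(* The difference of the two quadratic relations is the sum of h_i (m_i + n_i). One factor gives the
   known solution. The other gives its reflection along (d_i th_i), for the form whose diagonal
   entries are 1/d_i. *)
have : Z / Th * (Y + (n1 * th1 + n2 * th2 + n3 * th3)) = 0.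
  apply: etrans (_ : (m1 ^+ 2 / d1 + m2 ^+ 2 / d2 + m3 ^+ 2 / d3)
     - (n1 ^+ 2 / d1 + n2 ^+ 2 / d2 + n3 ^+ 2 / d3) = _); last by rewrite e3 e3' subrr.
  apply: etrans (_ : h1 * (m1 + n1) + h2 * (m2 + n2) + h3 * (m3 + n3) = _).
    by rewrite g1 g2 g3 /Y; ring.
  by rewrite /h1 /h2 /h3; ring.
move/eqP; rewrite mulf_eq0 => /orP[/eqP Z0|/eqP Y0].
  by left; rewrite n1E n2E n3E g1 g2 g3 Z0; split; ring.
right; have {ZY Y0} ZE : Z = 2%:R * Y.
  by rewrite ZY -[RHS]subr0 -Y0; ring.
by rewrite n1E n2E n3E g1 g2 g3 ZE; split; ring.
Qed.

End Reflection.

(** * Normal forms *)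

(* With y = (x, y, 1 - x - y) and lam3 = 1 - lam1 - lam2, the record stands for the
   map [id + X / L] with fixed points (1,0), (0,1), (0,0), (lam1,lam2), where
   L = ev1 y1 + ev2 y2 + ev3 y3 and
   X = lam1 a y2 y3 + lam2 b y1 y3 + lam3 c y1 y2,  a + b + c = 0.
   Any a, b give a vector field vanishing at the fourth point. *)
Record nform (R : Type) := NForm {
  lam1 : R; lam2 : R; ev1 : R; ev2 : R; ev3 : R; a1 : R; a2 : R; b1 : R; b2 : R }.

(** * Invariants and rigidity of normal forms *)

Section NormalFormInvariants.
Variable C : numClosedFieldType.
Implicit Types w : nform C.

Definition lam3 w := 1 - lam1 w - lam2 w.
Definition ev4 w := lam1 w * ev1 w + lam2 w * ev2 w + lam3 w * ev3 w.
Definition area w := a1 w * b2 w - a2 w * b1 w.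
(* [div1], [div2], [div3] are the divergences of X at the first three fixed points;
   [mtr4] and [mdet4] are the multipliers at the fourth one only when [ev4 w = 1],
   which fixes the scale of (X, L). *)
Definition div1 w := lam2 w * (- b1 w - b2 w) + lam3 w * (- a2 w - b2 w).
Definition div2 w := lam1 w * (- a1 w - a2 w) + lam3 w * (- a1 w - b1 w).
Definition div3 w := lam1 w * a2 w + lam2 w * b1 w.
(** At a zero of X the map id + X/L has differential I + DX/L, so the trace and determinant of I -
    Df are - div X / L and det DX / L^2. Since a + b + c = 0, any two of a, b, c span the same
    [area] up to sign. *)
Definition mtr1 w := - div1 w / ev1 w.
Definition mtr2 w := - div2 w / ev2 w.
Definition mtr3 w := - div3 w / ev3 w.
Definition mtr4 w := - (lam1 w * div1 w + lam2 w * div2 w + lam3 w * div3 w).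
Definition mdet1 w := - (lam2 w * lam3 w * area w) / ev1 w ^+ 2.
Definition mdet2 w := - (lam1 w * lam3 w * area w) / ev2 w ^+ 2.
Definition mdet3 w := - (lam1 w * lam2 w * area w) / ev3 w ^+ 2.
Definition mdet4 w := lam1 w * lam2 w * lam3 w * area w.

(* The cubic [y ^ X(y)] on the line, at [(x : y : 0)]. *)
Definition cub (p q s a a' b b' x y : C) : C :=
  let z := - x - y in
  x * (p * a' * y * z + q * b' * x * z + s * (- a' - b') * x * y)
  - y * (p * a * y * z + q * b * x * z + s * (- a - b) * x * y).

Definition cubw w x y :=
  cub (lam1 w) (lam2 w) (lam3 w) (a1 w) (a2 w) (b1 w) (b2 w) x y.
(* [(div2 - div3, div3 - div1)] spans the kernel of the linear part of the
   divergence of X, whose values at the vertices are [div1], [div2], [div3];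
   similarly for [cubL] and the linear part of L. *)
Definition cubD w := cubw w (div2 w - div3 w) (div3 w - div1 w).
Definition cubL w := cubw w (ev2 w - ev3 w) (ev3 w - ev1 w).

(* The vector fields vanishing at the four points with prescribed divergences
   [e1], [e2], [e3] at the first three form an affine line, parametrized by [r = a2]. *)
Definition sol_b1 (p q s e1 e2 e3 r : C) := (e3 - p * r) / q.
Definition sol_a1 (p q s e1 e2 e3 r : C) :=
  - (e2 + p * r + s * sol_b1 p q s e1 e2 e3 r) / (p + s).
Definition sol_b2 (p q s e1 e2 e3 r : C) :=
  - (e1 + q * sol_b1 p q s e1 e2 e3 r + s * r) / (q + s).
Definition cub_sol (p q s e1 e2 e3 r x y : C) :=
  cub p q s (sol_a1 p q s e1 e2 e3 r) r (sol_b1 p q s e1 e2 e3 r) (sol_b2 p q s e1 e2 e3 r) x y.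

(** When the denominators [q], [p + s], [q + s] are nonzero, the slope is the cubic of the
    divergence-free field with [a2 = 1] vanishing at the four points. *)
Lemma cub_sol_affine p q s e1 e2 e3 r x y :
  cub_sol p q s e1 e2 e3 r x y =
  cub_sol p q s e1 e2 e3 0 x y + r * cub_sol p q s 0 0 0 1 x y.
Proof. rewrite /cub_sol /sol_a1 /sol_b2 /sol_b1 /cub; ring. Qed.

Lemma nform_sol w : lam2 w != 0 -> lam1 w + lam3 w != 0 -> lam2 w + lam3 w != 0 ->
  [/\ a1 w = sol_a1 (lam1 w) (lam2 w) (lam3 w) (div1 w) (div2 w) (div3 w) (a2 w),
      b1 w = sol_b1 (lam1 w) (lam2 w) (lam3 w) (div1 w) (div2 w) (div3 w) (a2 w)
    & b2 w = sol_b2 (lam1 w) (lam2 w) (lam3 w) (div1 w) (div2 w) (div3 w) (a2 w)].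
Proof.
move=> h2 h13 h23; rewrite /sol_a1 /sol_b2.
have <- : b1 w = sol_b1 (lam1 w) (lam2 w) (lam3 w) (div1 w) (div2 w) (div3 w) (a2 w).
  by rewrite /sol_b1 /div3; field.
by rewrite /div1 /div2; split=> //; field.
Qed.

(* [alt_inv_ev] is the second solution of [line_quadric_roots], as the inverse of
   the values of L; [alt_lam], [- alt_mdiv], [ratio] are the weights, divergences
   and quotient of resultants that it forces. *)
Definition theta1 w := mtr2 w - mtr3 w.
Definition theta2 w := mtr3 w - mtr1 w.
Definition theta3 w := mtr1 w - mtr2 w.
Definition theta_sq w := mdet1 w * theta1 w ^+ 2 + mdet2 w * theta2 w ^+ 2 + mdet3 w * theta3 w ^+ 2.
Definition theta_pairing w := (ev1 w)^-1 * theta1 w + (ev2 w)^-1 * theta2 w + (ev3 w)^-1 * theta3 w.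
Definition alt_inv_ev1 w := (ev1 w)^-1 - 2%:R * theta_pairing w * mdet1 w * theta1 w / theta_sq w.
Definition alt_inv_ev2 w := (ev2 w)^-1 - 2%:R * theta_pairing w * mdet2 w * theta2 w / theta_sq w.
Definition alt_inv_ev3 w := (ev3 w)^-1 - 2%:R * theta_pairing w * mdet3 w * theta3 w / theta_sq w.

Definition alt_lam1 w := - mdet4 w * alt_inv_ev1 w ^+ 2 / mdet1 w.
Definition alt_lam2 w := - mdet4 w * alt_inv_ev2 w ^+ 2 / mdet2 w.
Definition alt_lam3 w := - mdet4 w * alt_inv_ev3 w ^+ 2 / mdet3 w.
Definition alt_mdiv1 w := mtr1 w / alt_inv_ev1 w.
Definition alt_mdiv2 w := mtr2 w / alt_inv_ev2 w.
Definition alt_mdiv3 w := mtr3 w / alt_inv_ev3 w.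
Definition ratio w := lam1 w * lam2 w * lam3 w / (alt_lam1 w * alt_lam2 w * alt_lam3 w).

Definition alt_cubD w e1 e2 e3 r :=
  cub_sol (alt_lam1 w) (alt_lam2 w) (alt_lam3 w) e1 e2 e3 r (alt_mdiv3 w - alt_mdiv2 w) (alt_mdiv1 w - alt_mdiv3 w).
Definition alt_cubL w e1 e2 e3 r :=
  cub_sol (alt_lam1 w) (alt_lam2 w) (alt_lam3 w) e1 e2 e3 r
    ((alt_inv_ev2 w)^-1 - (alt_inv_ev3 w)^-1) ((alt_inv_ev3 w)^-1 - (alt_inv_ev1 w)^-1).

Definition cubD_slope w :=
  cub_sol (lam1 w) (lam2 w) (lam3 w) 0 0 0 1 (div2 w - div3 w) (div3 w - div1 w).
(* The elimination of the parameter [r] between the two affine equations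
   [alt_cubD = ratio * cubD] and [alt_cubL = ratio * cubL]. *)
Definition alt_obstruction w :=
  alt_cubL w 0 0 0 1 * (ratio w * cubD w - alt_cubD w (- alt_mdiv1 w) (- alt_mdiv2 w) (- alt_mdiv3 w) 0)
  - alt_cubD w 0 0 0 1 * (ratio w * cubL w - alt_cubL w (- alt_mdiv1 w) (- alt_mdiv2 w) (- alt_mdiv3 w) 0).

(** The two sums are, up to sign, the coefficients of [a1] in [div2] and of [b2] in [div1]; with
    [lam2 w != 0] they make the linear system for the field solvable in terms of [a2]. *)
Definition nondegenerate w : Prop :=
  [/\ [/\ lam1 w != 0, lam2 w != 0 & lam3 w != 0],
      lam1 w + lam3 w != 0, lam2 w + lam3 w != 0,
      [/\ ev1 w != 0, ev2 w != 0 & ev3 w != 0] & ev4 w = 1].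

(** The Euler-Jacobi relations with the fourth term moved to the right. They reduce to three
    barycentric facts: L is affine, the divergence of X is affine, and the weights add up to 1. *)
Lemma nform_relations w : nondegenerate w -> area w != 0 ->
  [/\ (ev1 w)^-1 / mdet1 w + (ev2 w)^-1 / mdet2 w + (ev3 w)^-1 / mdet3 w = - (mdet4 w)^-1,
      mtr1 w * (ev1 w)^-1 / mdet1 w + mtr2 w * (ev2 w)^-1 / mdet2 w + mtr3 w * (ev3 w)^-1 / mdet3 w
        = - (mtr4 w / mdet4 w)
    & (ev1 w)^-1 ^+ 2 / mdet1 w + (ev2 w)^-1 ^+ 2 / mdet2 w + (ev3 w)^-1 ^+ 2 / mdet3 w
        = - (mdet4 w)^-1].
Proof.
move=> [[k1 k2 k3] _ _ [q1 q2 q3] l4E] ar.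
have sumE : lam1 w + lam2 w + lam3 w = 1 by rewrite /lam3; ring.
split.
- rewrite -[in RHS](mul1r (mdet4 w)^-1) -l4E /ev4 /mdet1 /mdet2 /mdet3 /mdet4.
  by field; rewrite k1 k2 k3 q1 q2 q3 ar.
- rewrite /mtr4 /mtr1 /mtr2 /mtr3 /mdet1 /mdet2 /mdet3 /mdet4.
  by field; rewrite k1 k2 k3 q1 q2 q3 ar.
- rewrite -[in RHS](mul1r (mdet4 w)^-1) -sumE /mdet1 /mdet2 /mdet3 /mdet4.
  by field; rewrite k1 k2 k3 q1 q2 q3 ar.
Qed.

Lemma weights_of_multipliers w : nondegenerate w -> area w != 0 ->
  [/\ lam1 w = - mdet4 w * (ev1 w)^-1 ^+ 2 / mdet1 w, lam2 w = - mdet4 w * (ev2 w)^-1 ^+ 2 / mdet2 w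
    & lam3 w = - mdet4 w * (ev3 w)^-1 ^+ 2 / mdet3 w].
Proof.
move=> [[k1 k2 k3] _ _ [q1 q2 q3] _] ar.
by rewrite /mdet4 /mdet1 /mdet2 /mdet3; split; field; rewrite ?k1 ?k2 ?k3 ?q1 ?q2 ?q3 ?ar.
Qed.

Lemma divergence_of_multipliers w : nondegenerate w ->
  [/\ div1 w = - (mtr1 w * ev1 w), div2 w = - (mtr2 w * ev2 w) & div3 w = - (mtr3 w * ev3 w)].
Proof.
by move=> [_ _ _ [q1 q2 q3] _]; rewrite /mtr1 /mtr2 /mtr3; split; field.
Qed.

Lemma cubw_sol w x y : nondegenerate w ->
  cubw w x y = cub_sol (lam1 w) (lam2 w) (lam3 w) (div1 w) (div2 w) (div3 w) (a2 w) x y.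
Proof.
move=> [[_ k2 _] k13 k23 _ _]; have [e1 e2 e3] := nform_sol k2 k13 k23.
by rewrite /cubw {1}e1 {1}e2 {1}e3.
Qed.

Lemma nform_eq w w' :
  lam1 w' = lam1 w -> lam2 w' = lam2 w ->
  ev1 w' = ev1 w -> ev2 w' = ev2 w -> ev3 w' = ev3 w ->
  a1 w' = a1 w -> a2 w' = a2 w -> b1 w' = b1 w -> b2 w' = b2 w -> w = w'.
Proof. by case: w w' => ? ? ? ? ? ? ? ? ? [] /= ? ? ? ? ? ? ? ? ? -> -> -> -> -> -> -> -> ->. Qed.

Lemma nform_rigidity w w' rho :
  nondegenerate w -> nondegenerate w' -> area w != 0 -> area w' != 0 ->
  theta_sq w != 0 -> cubD_slope w != 0 -> alt_obstruction w != 0 ->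
  [/\ mtr1 w' = mtr1 w, mtr2 w' = mtr2 w, mtr3 w' = mtr3 w & mtr4 w' = mtr4 w] ->
  [/\ mdet1 w' = mdet1 w, mdet2 w' = mdet2 w, mdet3 w' = mdet3 w & mdet4 w' = mdet4 w] ->
  lam1 w' * lam2 w' * lam3 w' * area w' ^+ 2
    = rho * (lam1 w * lam2 w * lam3 w * area w ^+ 2) ->
  cubD w' = rho * cubD w -> cubL w' = rho * cubL w -> w = w'.
Proof.
move=> nw nw' ar ar' theta_sq0 sl0 Psi0 [tE1 tE2 tE3 tE4] [dE1 dE2 dE3 dE4] rhoE cD cL.
have [[k1 k2 k3] k13 k23 [q1 q2 q3] _] := nw.
have [[k1' k2' k3'] k13' k23' [q1' q2' q3'] _] := nw'.
have [d10 d20 d30 d40] : [/\ mdet1 w != 0, mdet2 w != 0, mdet3 w != 0 & mdet4 w != 0].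
  by rewrite /mdet1 /mdet2 /mdet3 /mdet4; split; rewrite ?(mulf_neq0, invr_eq0, oppr_eq0, expf_neq0).
have [r1 r2 r3] := nform_relations nw ar; have := nform_relations nw' ar'.
rewrite dE1 dE2 dE3 dE4 tE1 tE2 tE3 tE4 => -[r1' r2' r3'].
have [W1 W2 W3] := weights_of_multipliers nw ar.
have := weights_of_multipliers nw' ar'; rewrite dE1 dE2 dE3 dE4 => -[W1' W2' W3'].
have [G1 G2 G3] := divergence_of_multipliers nw.
have := divergence_of_multipliers nw'; rewrite tE1 tE2 tE3 => -[G1' G2' G3'].
have [[n1 n2 n3]|[n1 n2 n3]] := line_quadric_roots d10 d20 d30 theta_sq0 r1 r1' r2 r2' r3 r3'.
- move: n1 n2 n3 (n1) (n2) (n3) W1' W2' W3' => /invr_inj l1E /invr_inj l2E /invr_inj l3E.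
  move=> -> -> ->; rewrite -W1 -W2 -W3 => L1 L2 L3.
  move: G1' G2' G3'; rewrite l1E l2E l3E -G1 -G2 -G3 => E1 E2 E3.
  have p0 : lam1 w * lam2 w * lam3 w != 0 by rewrite !mulf_neq0.
  have arE : area w' = area w by apply: (mulfI p0); move: dE4; rewrite /mdet4 L1 L2 L3.
  (* Here the weights and [area] are already those of [w], so the resultants agree. *)
  have rho1 : rho = 1.
    have pa0 : lam1 w * lam2 w * lam3 w * area w ^+ 2 != 0.
      by rewrite mulf_neq0 // expf_neq0.
    by apply: (mulIf pa0); rewrite -rhoE L1 L2 L3 arE mul1r.
  (* Only [a2] is still unknown. The divergences agree, so both cubics are evaluated at the same
     point and differ by [cubD_slope] times the difference of the parameters. *)
  have aE : a2 w' = a2 w.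
    move: cD; rewrite rho1 mul1r /cubD !cubw_sol // E1 E2 E3 L1 L2 L3.
    rewrite [LHS]cub_sol_affine [RHS]cub_sol_affine => /addrI.
    exact: (mulIf sl0).
  have [F1 F2 F3] := nform_sol k2 k13 k23; have [F1' F2' F3'] := nform_sol k2' k13' k23'.
  by apply: nform_eq => //; rewrite ?F1 ?F1' ?F2 ?F2' ?F3 ?F3' ?E1 ?E2 ?E3 ?L1 ?L2 ?L3 ?aE.
- case/eqP: Psi0.
  have M1 : (ev1 w')^-1 = alt_inv_ev1 w by [].
  have M2 : (ev2 w')^-1 = alt_inv_ev2 w by [].
  have M3 : (ev3 w')^-1 = alt_inv_ev3 w by [].
  have {W1'} L1 : lam1 w' = alt_lam1 w by rewrite W1' M1.
  have {W2'} L2 : lam2 w' = alt_lam2 w by rewrite W2' M2.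
  have {W3'} L3 : lam3 w' = alt_lam3 w by rewrite W3' M3.
  have {G1'} E1 : div1 w' = - alt_mdiv1 w by rewrite G1' /alt_mdiv1 -M1 invrK.
  have {G2'} E2 : div2 w' = - alt_mdiv2 w by rewrite G2' /alt_mdiv2 -M2 invrK.
  have {G3'} E3 : div3 w' = - alt_mdiv3 w by rewrite G3' /alt_mdiv3 -M3 invrK.
  (* [mdet4] fixes the product of the weights times [area], while the resultant carries [area]
     squared; so the resultants are inversely proportional to the products of the weights. *)
  have rhoR : rho = ratio w.
    have p0 : lam1 w * lam2 w * lam3 w != 0 by rewrite !mulf_neq0.
    have p0' : alt_lam1 w * alt_lam2 w * alt_lam3 w != 0 by rewrite -L1 -L2 -L3 !mulf_neq0.
    move: dE4 rhoE; rewrite /mdet4 /ratio L1 L2 L3.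
    set p := lam1 w * _ * _ in p0 *; set p' := alt_lam1 w * _ * _ in p0' * => e4 e.
    have -> : rho = (p' * area w' ^+ 2) / (p * area w ^+ 2).
      by rewrite e; field; rewrite p0 ar.
    have -> : area w' = p * area w / p' by rewrite -e4; field.
    by field; rewrite p0 p0' ar.
  have cD' : ratio w * cubD w = alt_cubD w (- alt_mdiv1 w) (- alt_mdiv2 w) (- alt_mdiv3 w) (a2 w').
    rewrite -rhoR -cD /cubD cubw_sol // L1 L2 L3 E1 E2 E3 /alt_cubD.
    by congr (cub_sol _ _ _ _ _ _ _ _ _); ring.
  have cL' : ratio w * cubL w = alt_cubL w (- alt_mdiv1 w) (- alt_mdiv2 w) (- alt_mdiv3 w) (a2 w').
    by rewrite -rhoR -cL /cubL cubw_sol // L1 L2 L3 E1 E2 E3 /alt_cubL -M1 -M2 -M3 !invrK.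
  (* Each bracket of the obstruction becomes its slope times [a2 w'], and the two cross products
     cancel. *)
  rewrite /alt_obstruction cD' cL' [alt_cubD _ _ _ _ (a2 w')]cub_sol_affine.
  by rewrite [alt_cubL _ _ _ _ (a2 w')]cub_sol_affine /alt_cubD /alt_cubL; ring.
Qed.

End NormalFormInvariants.

(** * Binary quadratic vector fields in a frame of eigenvectors *)

Section BinaryFields.
Variable C : numClosedFieldType.

(** On the line X is a Q1 + b Q2, by c = - a - b. The left side is the resultant of Q1 and Q2
    written in the basis (x1, y1), (x2, y2), where [P1] and [P2] are the mixed coefficients; a
    change of basis multiplies it by the fourth power of the determinant. *)
Lemma kernel_resultant (p q s x1 y1 x2 y2 : C) : p + q + s = 1 ->
  let Q1 x y := y * (p * (- x - y) - s * x) in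
  let Q2 x y := x * (q * (- x - y) - s * y) in
  let P1 := Q1 (x1 + x2) (y1 + y2) - Q1 x1 y1 - Q1 x2 y2 in
  let P2 := Q2 (x1 + x2) (y1 + y2) - Q2 x1 y1 - Q2 x2 y2 in
  (Q1 x1 y1 * Q2 x2 y2 - Q2 x1 y1 * Q1 x2 y2) ^+ 2
  - (Q1 x1 y1 * P2 - Q2 x1 y1 * P1) * (P1 * Q2 x2 y2 - P2 * Q1 x2 y2)
  = - (p * q * s) * (x1 * y2 - x2 * y1) ^+ 4.
Proof.
move=> h /=; have -> : s = 1 - p - q by rewrite -h; ring.
ring.
Qed.

(** The divergence at v1 is the trace of DX(v1), which sends v1 to 2 k1 v1 and v2 to (k3 - k1) v1 +
    (k3 - k2) v2; similarly at v2. *)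
Lemma eigenframe_divergence (A0 A1 A2 B0 B1 B2 x1 y1 x2 y2 k1 k2 k3 : C) :
  let X x y := A0 * x ^+ 2 + A1 * x * y + A2 * y ^+ 2 in
  let X' x y := B0 * x ^+ 2 + B1 * x * y + B2 * y ^+ 2 in
  x1 * y2 - x2 * y1 != 0 ->
  X x1 y1 = k1 * x1 -> X' x1 y1 = k1 * y1 ->
  X x2 y2 = k2 * x2 -> X' x2 y2 = k2 * y2 ->
  X (x1 + x2) (y1 + y2) = k3 * (x1 + x2) -> X' (x1 + x2) (y1 + y2) = k3 * (y1 + y2) ->
  (2%:R * A0 + B1) * x1 + (A1 + 2%:R * B2) * y1 = 2%:R * k1 + k3 - k2 /\
  (2%:R * A0 + B1) * x2 + (A1 + 2%:R * B2) * y2 = 2%:R * k2 + k3 - k1.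
Proof.
move=> X X' tau0 e1 e1' e2 e2' e3 e3'.
split; apply: (mulIf tau0).
- apply: etrans (_ : 2%:R * (X x1 y1 * y2 - X' x1 y1 * x2)
   + (x1 * (X' (x1 + x2) (y1 + y2) - X' x1 y1 - X' x2 y2)
      - y1 * (X (x1 + x2) (y1 + y2) - X x1 y1 - X x2 y2)) = _).
    by rewrite /X /X'; ring.
  by rewrite e1 e1' e2 e2' e3 e3'; ring.
- apply: etrans (_ : 2%:R * (x1 * X' x2 y2 - y1 * X x2 y2)
   + ((X (x1 + x2) (y1 + y2) - X x1 y1 - X x2 y2) * y2
      - (X' (x1 + x2) (y1 + y2) - X' x1 y1 - X' x2 y2) * x2) = _).
    by rewrite /X /X'; ring.
  by rewrite e1 e1' e2 e2' e3 e3'; ring.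
Qed.

(** K vanishes on v1, v2 and v1 + v2, hence is a constant times the product of the three
    determinants against them. At the zero (q, - p) of a linear form these determinants are, up to
    sign, the values of the form on the three vectors. *)
Lemma eigenframe_cubic (A0 A1 A2 B0 B1 B2 x1 y1 x2 y2 k1 k2 k3 p q : C) :
  let X x y := A0 * x ^+ 2 + A1 * x * y + A2 * y ^+ 2 in
  let X' x y := B0 * x ^+ 2 + B1 * x * y + B2 * y ^+ 2 in
  let K x y := x * X' x y - y * X x y in
  let L1 := p * x1 + q * y1 in let L2 := p * x2 + q * y2 in
  let tau := x1 * y2 - x2 * y1 in
  tau != 0 ->
  X x1 y1 = k1 * x1 -> X' x1 y1 = k1 * y1 ->
  X x2 y2 = k2 * x2 -> X' x2 y2 = k2 * y2 ->
  X (x1 + x2) (y1 + y2) = k3 * (x1 + x2) -> X' (x1 + x2) (y1 + y2) = k3 * (y1 + y2) ->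
  K q (- p) * tau ^+ 2 = L1 * L2 * (L1 + L2) * (k1 + k2 - k3).
Proof.
move=> X X' K L1 L2 tau tau0 e1 e1' e2 e2' e3 e3'.
apply: (mulIf tau0).
(* The field at L1 v2 - L2 v1, expanded by polarization. That vector is [tau] times (- q, p), the
   zero of the linear form. *)
pose XX := L2 ^+ 2 * X x1 y1 + L1 ^+ 2 * X x2 y2
  - L1 * L2 * (X (x1 + x2) (y1 + y2) - X x1 y1 - X x2 y2).
pose XX' := L2 ^+ 2 * X' x1 y1 + L1 ^+ 2 * X' x2 y2
  - L1 * L2 * (X' (x1 + x2) (y1 + y2) - X' x1 y1 - X' x2 y2).
have nx : L1 * x2 - L2 * x1 = - (tau * q) by rewrite /L1 /L2 /tau; ring.
have ny : L1 * y2 - L2 * y1 = tau * p by rewrite /L1 /L2 /tau; ring.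
apply: etrans (_ : - ((L1 * x2 - L2 * x1) * XX' - (L1 * y2 - L2 * y1) * XX) = _).
  have -> : XX = X (L1 * x2 - L2 * x1) (L1 * y2 - L2 * y1) by rewrite /XX /X; ring.
  have -> : XX' = X' (L1 * x2 - L2 * x1) (L1 * y2 - L2 * y1) by rewrite /XX' /X'; ring.
  by rewrite nx ny /K /X /X'; ring.
by rewrite /XX /XX' e1 e1' e2 e2' e3 e3' /tau; ring.
Qed.

Lemma planar_same_point (x1 y1 x2 y2 : C) : r3 x1 y1 0 != 0 -> r3 x2 y2 0 != 0 ->
  x1 * y2 - x2 * y1 = 0 -> same_point (r3 x1 y1 0) (r3 x2 y2 0).
Proof.
move=> n1 n2 d0.
have [x20|x20] := eqVneq x2 0.
  have y20 : y2 != 0.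
    by apply: contra_neq n2 => y20; apply: rv3P; rewrite co_r3 co0.
  have x10 : x1 = 0.
    by apply: (mulIf y20); rewrite mul0r -d0 x20; ring.
  have y10 : y1 != 0.
    by apply: contra_neq n1 => y10; apply: rv3P; rewrite co_r3 co0.
  exists (y1 / y2); split; first by rewrite mulf_neq0 ?invr_eq0.
  by apply: rv3P; rewrite co_scale !co_r3 ?x10 ?x20 ?mulr0 // divfK.
have y1E : y1 = x1 / x2 * y2.
  apply: (mulfI x20); have -> : x2 * (x1 / x2 * y2) = x1 * y2 by field.
  by apply/esym/eqP; rewrite -subr_eq0 d0.
exists (x1 / x2); split.
  rewrite mulf_neq0 ?invr_eq0 //; apply: contra_neq n1 => x10.
  by apply: rv3P; rewrite co_r3 co0 // y1E x10 !mul0r.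
by apply: rv3P; rewrite co_scale !co_r3 ?mulr0 // divfK.
Qed.

End BinaryFields.

(** * The normal form as a self-map of the plane *)

Section NormalForm.
Variable C : numClosedFieldType.
Implicit Types w : nform C.

Definition nfmx w : 'M[C]_(3, 6) :=
  let p := lam1 w in let q := lam2 w in let s := lam3 w in
  \matrix_(i < 3, j < 6) nth 0 (nth [::]
  [:: [:: ev1 w - ev3 w - q * b1 w; - (p * a1 w); 0;
          ev2 w - ev3 w - p * a1 w - q * b1 w + s * (- a1 w - b1 w);
          ev3 w + q * b1 w; p * a1 w];
      [:: - (q * b2 w); ev2 w - ev3 w - p * a2 w; 0;
          ev1 w - ev3 w - p * a2 w - q * b2 w + s * (- a2 w - b2 w);
          q * b2 w; ev3 w + p * a2 w];
      [:: 0; 0; ev3 w; 0; ev1 w - ev3 w; ev2 w - ev3 w]] i) j.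

Lemma nfmxE0 w :
  (nfmx w i0 (inord 0) = ev1 w - ev3 w - lam2 w * b1 w) *
  (nfmx w i0 (inord 1) = - (lam1 w * a1 w)) *
  (nfmx w i0 (inord 2) = 0) *
  (nfmx w i0 (inord 3) = ev2 w - ev3 w - lam1 w * a1 w - lam2 w * b1 w
                         + lam3 w * (- a1 w - b1 w)) *
  (nfmx w i0 (inord 4) = ev3 w + lam2 w * b1 w) *
  (nfmx w i0 (inord 5) = lam1 w * a1 w).
Proof. by rewrite !mxE !inordK. Qed.

Lemma nfmxE1 w :
  (nfmx w i1 (inord 0) = - (lam2 w * b2 w)) *
  (nfmx w i1 (inord 1) = ev2 w - ev3 w - lam1 w * a2 w) *
  (nfmx w i1 (inord 2) = 0) *
  (nfmx w i1 (inord 3) = ev1 w - ev3 w - lam1 w * a2 w - lam2 w * b2 w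
                         + lam3 w * (- a2 w - b2 w)) *
  (nfmx w i1 (inord 4) = lam2 w * b2 w) *
  (nfmx w i1 (inord 5) = ev3 w + lam1 w * a2 w).
Proof. by rewrite !mxE !inordK. Qed.

Lemma nfmxE2 w :
  (nfmx w i2 (inord 0) = 0) * (nfmx w i2 (inord 1) = 0) *
  (nfmx w i2 (inord 2) = ev3 w) * (nfmx w i2 (inord 3) = 0) *
  (nfmx w i2 (inord 4) = ev1 w - ev3 w) * (nfmx w i2 (inord 5) = ev2 w - ev3 w).
Proof. by rewrite !mxE !inordK. Qed.

Definition nfmxE w := (nfmxE0 w, nfmxE1 w, nfmxE2 w).

Definition Lin w x y z := (ev1 w - ev3 w) * x + (ev2 w - ev3 w) * y + ev3 w * z.
Definition vfx w x y z := lam1 w * a1 w * y * (z - x - y)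
  + lam2 w * b1 w * x * (z - x - y) + lam3 w * (- a1 w - b1 w) * x * y.
Definition vfy w x y z := lam1 w * a2 w * y * (z - x - y)
  + lam2 w * b2 w * x * (z - x - y) + lam3 w * (- a2 w - b2 w) * x * y.

Lemma qeval_nfmx w x y z :
  qeval (nfmx w) (r3 x y z) =
  r3 (x * Lin w x y z + vfx w x y z) (y * Lin w x y z + vfy w x y z) (z * Lin w x y z).
Proof.
by apply: rv3P; rewrite co_qeval !co_r3 !nfmxE /Lin /vfx /vfy; ring.
Qed.

Lemma nfmx_inv_line w : inv_line (nfmx w).
Proof. by move=> x x2; rewrite co_qeval !nfmxE x2; ring. Qed.

Definition pt1 : 'rV[C]_3 := r3 1 0 1.
Definition pt2 : 'rV[C]_3 := r3 0 1 1.
Definition pt3 : 'rV[C]_3 := r3 0 0 1.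
Definition pt4 w : 'rV[C]_3 := r3 (lam1 w) (lam2 w) 1.

Lemma affine_neq0 (x y : C) : r3 x y 1 != 0.
Proof.
apply/eqP=> /(congr1 (fun v => co v i2)); rewrite co_r3 co0 => /eqP.
by rewrite oner_eq0.
Qed.

Lemma nfmx_pt1 w : qeval (nfmx w) pt1 = ev1 w *: pt1.
Proof. by rewrite qeval_nfmx; apply: rv3P; rewrite co_scale !co_r3 /Lin /vfx /vfy; ring. Qed.
Lemma nfmx_pt2 w : qeval (nfmx w) pt2 = ev2 w *: pt2.
Proof. by rewrite qeval_nfmx; apply: rv3P; rewrite co_scale !co_r3 /Lin /vfx /vfy; ring. Qed.
Lemma nfmx_pt3 w : qeval (nfmx w) pt3 = ev3 w *: pt3.
Proof. by rewrite qeval_nfmx; apply: rv3P; rewrite co_scale !co_r3 /Lin /vfx /vfy; ring. Qed.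
Lemma nfmx_pt4 w : qeval (nfmx w) (pt4 w) = ev4 w *: pt4 w.
Proof.
by rewrite qeval_nfmx; apply: rv3P; rewrite co_scale !co_r3 /ev4 /Lin /vfx /vfy /lam3; ring.
Qed.

Lemma scalemxE n (c : C) (B : 'M[C]_n) i j : (c *: B) i j = c * B i j.
Proof. by rewrite mxE. Qed.

Lemma nfmx_pt1_mult w : ev1 w != 0 ->
  tI (nfmx w) pt1 = mtr1 w /\ dI (nfmx w) pt1 = mdet1 w.
Proof.
move=> l0; have [-> ->] := fixed_tI_dI (affine_neq0 _ _) l0 (nfmx_pt1 w).
rewrite tr_ord3 det_ord3 !sub1mxE !scalemxE !ord3_eqF !eqxx /= ?mulr0n ?mulr1n
    !JF_E !co_r3 !nfmxE /mtr1 /mdet1 /div1 /area; split; field; rewrite ?l0 //.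
Qed.

Lemma nfmx_pt2_mult w : ev2 w != 0 ->
  tI (nfmx w) pt2 = mtr2 w /\ dI (nfmx w) pt2 = mdet2 w.
Proof.
move=> l0; have [-> ->] := fixed_tI_dI (affine_neq0 _ _) l0 (nfmx_pt2 w).
rewrite tr_ord3 det_ord3 !sub1mxE !scalemxE !ord3_eqF !eqxx /= ?mulr0n ?mulr1n
    !JF_E !co_r3 !nfmxE /mtr2 /mdet2 /div2 /area; split; field; rewrite ?l0 //.
Qed.

Lemma nfmx_pt3_mult w : ev3 w != 0 ->
  tI (nfmx w) pt3 = mtr3 w /\ dI (nfmx w) pt3 = mdet3 w.
Proof.
move=> l0; have [-> ->] := fixed_tI_dI (affine_neq0 _ _) l0 (nfmx_pt3 w).
rewrite tr_ord3 det_ord3 !sub1mxE !scalemxE !ord3_eqF !eqxx /= ?mulr0n ?mulr1n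
    !JF_E !co_r3 !nfmxE /mtr3 /mdet3 /div3 /area; split; field; rewrite ?l0 //.
Qed.

Lemma nfmx_pt4_mult w : ev4 w = 1 ->
  tI (nfmx w) (pt4 w) = mtr4 w /\ dI (nfmx w) (pt4 w) = mdet4 w.
Proof.
move=> l41; have l0 : ev4 w != 0 by rewrite l41 oner_eq0.
have [-> ->] := fixed_tI_dI (affine_neq0 _ _) l0 (nfmx_pt4 w).
have -> : mtr4 w = mtr4 w / ev4 w by rewrite l41 divr1.
have -> : mdet4 w = mdet4 w / ev4 w ^+ 2 by rewrite l41 expr1n divr1.
have l0' : lam1 w * ev1 w + lam2 w * ev2 w + (1 - lam1 w - lam2 w) * ev3 w != 0 by [].
rewrite tr_ord3 det_ord3 !sub1mxE !scalemxE !ord3_eqF !eqxx /= ?mulr0n ?mulr1n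
    !JF_E !co_r3 !nfmxE /mtr4 /mdet4 /div1 /div2 /div3 /area /ev4 /lam3; split; field; rewrite ?l0' //.
Qed.

End NormalForm.

(** * Invariants carried by the multipliers on the line *)

Section LineData.
Variable C : numClosedFieldType.
Implicit Types w : nform C.

Definition Dlin w x y := (div1 w - div3 w) * x + (div2 w - div3 w) * y.

(** The fixed points on the line are the eigendirections of X there. The map has eigenvalue L + xi,
    nonzero by holomorphy, and nondegeneracy makes the tangential multiplier nonzero. *)
Lemma nfmx_line_mult w x y : holo (nfmx w) ->
  (forall p, is_fixed (nfmx w) p -> dI (nfmx w) p != 0) ->
  let p := r3 x y 0 in is_fixed (nfmx w) p ->
  exists xi, let L := Lin w x y 0 in
   [/\ vfx w x y 0 = xi * x /\ vfy w x y 0 = xi * y, L + xi != 0,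
       uI (nfmx w) p != 0, vI (nfmx w) p * (L + xi) = xi
     & uI (nfmx w) p * (L + xi) = 3%:R * xi - Dlin w x y].
Proof.
move=> hh hd p fp; have [p0 [mu e]] := fp.
have mu0 := holo_eigen_neq0 hh p0 e.
have p2 : co p i2 = 0 by rewrite co_r3.
have [vE dE] := line_fixed_vI (@nfmx_inv_line _ w) p0 mu0 e p2.
have [tE _] := fixed_tI_dI p0 mu0 e.
have u0 : uI (nfmx w) p != 0.
  by apply: contra_neq (hd _ fp) => u0; rewrite dE u0 mul0r.
exists (mu - Lin w x y 0) => /=.
have -> : Lin w x y 0 + (mu - Lin w x y 0) = mu by ring.
split=> //.
- have := (congr1 (fun v => co v i0) e, congr1 (fun v => co v i1) e).
  rewrite qeval_nfmx !co_scale !co_r3 => -[e0 e1].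
  by rewrite !mulrBl -e0 -e1; split; ring.
- rewrite vE !JF_E !co_r3 !nfmxE /Lin; field.
  by rewrite mu0.
- have -> : uI (nfmx w) p = tI (nfmx w) p - vI (nfmx w) p by rewrite /vI; ring.
  rewrite tE vE tr_ord3 !JF_E !co_r3 !nfmxE /Lin /Dlin /div1 /div2 /div3; field.
  by rewrite mu0.
Qed.

(** The components of X combine Q1 and Q2 with determinant [area], which multiplies their resultant
    by [area ^+ 2]. In the frame the components have coefficients (k1, k3 - k1, 0) and (0, k3 - k2,
    k2), with resultant k1 k2 k3 (k1 + k2 - k3). *)
Lemma resultant_eigenframe w x1 y1 x2 y2 k1 k2 k3 :
  let tau := x1 * y2 - x2 * y1 in tau != 0 ->
  vfx w x1 y1 0 = k1 * x1 -> vfy w x1 y1 0 = k1 * y1 ->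
  vfx w x2 y2 0 = k2 * x2 -> vfy w x2 y2 0 = k2 * y2 ->
  vfx w (x1 + x2) (y1 + y2) 0 = k3 * (x1 + x2) ->
  vfy w (x1 + x2) (y1 + y2) 0 = k3 * (y1 + y2) ->
  lam1 w * lam2 w * lam3 w * area w ^+ 2 * tau ^+ 2 = - (k1 * k2 * k3 * (k1 + k2 - k3)).
Proof.
move=> tau tau0 e1 e1' e2 e2' e3 e3'.
apply: (mulIf (expf_neq0 2 tau0)); apply/oppr_inj.
have sumE : lam1 w + lam2 w + lam3 w = 1 by rewrite /lam3; ring.
have := kernel_resultant x1 y1 x2 y2 sumE; rewrite -/tau /=.
set Q1 := y1 * _; set Q2 := y2 * _; set R1 := x1 * _; set R2 := x2 * _.
set S1 := (y1 + y2) * _; set S2 := (x1 + x2) * _ => kr.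
have wd u v u' v' : area w * (u * v' - u' * v)
   = (a1 w * u + b1 w * u') * (a2 w * v + b2 w * v')
     - (a2 w * u + b2 w * u') * (a1 w * v + b1 w * v').
  by rewrite /area; ring.
have E1 : a1 w * Q1 + b1 w * R1 = k1 * x1 by rewrite -e1 /vfx /Q1 /R1; ring.
have E1' : a2 w * Q1 + b2 w * R1 = k1 * y1 by rewrite -e1' /vfy /Q1 /R1; ring.
have E2 : a1 w * Q2 + b1 w * R2 = k2 * x2 by rewrite -e2 /vfx /Q2 /R2; ring.
have E2' : a2 w * Q2 + b2 w * R2 = k2 * y2 by rewrite -e2' /vfy /Q2 /R2; ring.
have E3 : a1 w * (S1 - Q1 - Q2) + b1 w * (S2 - R1 - R2) = (k3 - k1) * x1 + (k3 - k2) * x2.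
  apply: etrans (_ : k3 * (x1 + x2) - k1 * x1 - k2 * x2 = _); last by ring.
  by rewrite -e3 -e1 -e2 /vfx /S1 /S2 /Q1 /Q2 /R1 /R2; ring.
have E3' : a2 w * (S1 - Q1 - Q2) + b2 w * (S2 - R1 - R2) = (k3 - k1) * y1 + (k3 - k2) * y2.
  apply: etrans (_ : k3 * (y1 + y2) - k1 * y1 - k2 * y2 = _); last by ring.
  by rewrite -e3' -e1' -e2' /vfy /S1 /S2 /Q1 /Q2 /R1 /R2; ring.
apply: etrans (_ : area w ^+ 2 * (- (lam1 w * lam2 w * lam3 w) * tau ^+ 4) = _); first by ring.
rewrite -kr.
apply: etrans (_ : (area w * (Q1 * R2 - Q2 * R1)) ^+ 2
  - (area w * (Q1 * (S2 - R1 - R2) - (S1 - Q1 - Q2) * R1))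
    * (area w * ((S1 - Q1 - Q2) * R2 - Q2 * (S2 - R1 - R2))) = _); first by ring.
have -> : Q1 * R2 - Q2 * R1 = Q1 * R2 - R1 * Q2 by ring.
have -> : Q1 * (S2 - R1 - R2) - (S1 - Q1 - Q2) * R1 = Q1 * (S2 - R1 - R2) - R1 * (S1 - Q1 - Q2) by ring.
have -> : (S1 - Q1 - Q2) * R2 - Q2 * (S2 - R1 - R2) = (S1 - Q1 - Q2) * R2 - (S2 - R1 - R2) * Q2 by ring.
by rewrite !wd E1 E1' E2 E2' E3 E3' /tau; ring.
Qed.

(* [g] is [kap ^+ 4 / tau ^+ 2]: the three quantities have the same weight under
   a change of basis of the line, so that their ratios are invariants. *)
Lemma eigenframe_line_data w x1 y1 x2 y2 k1 k2 k3 u1 u2 u3 v1 v2 v3 :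
  let tau := x1 * y2 - x2 * y1 in tau != 0 ->
  let x3 := x1 + x2 in let y3 := y1 + y2 in
  vfx w x1 y1 0 = k1 * x1 /\ vfy w x1 y1 0 = k1 * y1 ->
  vfx w x2 y2 0 = k2 * x2 /\ vfy w x2 y2 0 = k2 * y2 ->
  vfx w x3 y3 0 = k3 * x3 /\ vfy w x3 y3 0 = k3 * y3 ->
  u1 != 0 -> u2 != 0 -> u3 != 0 -> Lin w x1 y1 0 + k1 != 0 ->
  v1 * (Lin w x1 y1 0 + k1) = k1 -> u1 * (Lin w x1 y1 0 + k1) = 3%:R * k1 - Dlin w x1 y1 ->
  v2 * (Lin w x2 y2 0 + k2) = k2 -> u2 * (Lin w x2 y2 0 + k2) = 3%:R * k2 - Dlin w x2 y2 ->
  v3 * (Lin w x3 y3 0 + k3) = k3 -> u3 * (Lin w x3 y3 0 + k3) = 3%:R * k3 - Dlin w x3 y3 ->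
  let r1 := v1 / u1 in let r2 := v2 / u2 in let r3 := v3 / u3 in
  let s1 := (1 - v1) / u1 in let s2 := (1 - v2) / u2 in
  exists2 g, g != 0 &
  [/\ lam1 w * lam2 w * lam3 w * area w ^+ 2 = g * (r1 * r2 * r3),
      cubD w = g * ((3%:R * r1 - 1) * (3%:R * r2 - 1) * (3%:R * r1 + 3%:R * r2 - 2%:R))
    & cubL w = g * (s1 * s2 * (s1 + s2))].
Proof.
move=> tau tau0 x3 y3 [e1 e1'] [e2 e2'] [e3 e3'] u10 u20 u30 Lk0 ve1 ue1 ve2 ue2 ve3 ue3.
pose A0 := - (lam2 w * b1 w); pose A1 := - lam1 w * a1 w - lam2 w * b1 w + lam3 w * (- a1 w - b1 w).
pose A2 := - (lam1 w * a1 w).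
pose B0 := - (lam2 w * b2 w); pose B1 := - lam1 w * a2 w - lam2 w * b2 w + lam3 w * (- a2 w - b2 w).
pose B2 := - (lam1 w * a2 w).
have XE x y : vfx w x y 0 = A0 * x ^+ 2 + A1 * x * y + A2 * y ^+ 2.
  by rewrite /vfx /A0 /A1 /A2; ring.
have XE' x y : vfy w x y 0 = B0 * x ^+ 2 + B1 * x * y + B2 * y ^+ 2.
  by rewrite /vfy /B0 /B1 /B2; ring.
have DE x y : Dlin w x y = (2%:R * A0 + B1) * x + (A1 + 2%:R * B2) * y.
  by rewrite /Dlin /div1 /div2 /div3 /A0 /A1 /B1 /B2; ring.
have res := resultant_eigenframe tau0 e1 e1' e2 e2' e3 e3'.
rewrite !XE in e1 e2 e3; rewrite !XE' in e1' e2' e3'.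
have [d1E d2E] := eigenframe_divergence tau0 e1 e1' e2 e2' e3 e3'.
have KE x y : cubw w x y = x * (B0 * x ^+ 2 + B1 * x * y + B2 * y ^+ 2)
   - y * (A0 * x ^+ 2 + A1 * x * y + A2 * y ^+ 2).
  by rewrite /cubw /cub /A0 /A1 /A2 /B0 /B1 /B2; ring.
have cD := eigenframe_cubic (div1 w - div3 w) (div2 w - div3 w) tau0 e1 e1' e2 e2' e3 e3'.
have cL := eigenframe_cubic (ev1 w - ev3 w) (ev2 w - ev3 w) tau0 e1 e1' e2 e2' e3 e3'.
set kap := k1 + k2 - k3 in res cD cL.
have D1E : Dlin w x1 y1 = 3%:R * k1 - kap by rewrite DE d1E /kap; ring.
have D2E : Dlin w x2 y2 = 3%:R * k2 - kap by rewrite DE d2E /kap; ring.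
have D3E : Dlin w x3 y3 = 3%:R * k3 + kap.
  have -> : Dlin w x3 y3 = Dlin w x1 y1 + Dlin w x2 y2 by rewrite /Dlin /x3 /y3; ring.
  by rewrite D1E D2E /kap; ring.
(* All three numerators of the tangential multipliers are [kap] up to sign; this is what expresses
   each k_j and L(v_j) through one pair of multipliers and [kap]. *)
have {}ue1 : u1 * (Lin w x1 y1 0 + k1) = kap by rewrite ue1 D1E; ring.
have {}ue2 : u2 * (Lin w x2 y2 0 + k2) = kap by rewrite ue2 D2E; ring.
have {}ue3 : u3 * (Lin w x3 y3 0 + k3) = - kap by rewrite ue3 D3E; ring.
have kap0 : kap != 0 by rewrite -ue1 mulf_neq0.
have S1 : Lin w x1 y1 0 + k1 = kap / u1 by rewrite -ue1; field.
have S2 : Lin w x2 y2 0 + k2 = kap / u2 by rewrite -ue2; field.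
have S3 : Lin w x3 y3 0 + k3 = - kap / u3 by rewrite -ue3; field.
have k1E : k1 = kap * (v1 / u1) by rewrite -[LHS]ve1 S1; ring.
have k2E : k2 = kap * (v2 / u2) by rewrite -[LHS]ve2 S2; ring.
have k3E : k3 = - kap * (v3 / u3) by rewrite -[LHS]ve3 S3; ring.
have L1E : Lin w x1 y1 0 = kap * ((1 - v1) / u1).
  by rewrite -[LHS](addrK k1) S1 k1E; ring.
have L2E : Lin w x2 y2 0 = kap * ((1 - v2) / u2).
  by rewrite -[LHS](addrK k2) S2 k2E; ring.
have tau20 : tau ^+ 2 != 0 by rewrite expf_neq0.
exists (kap ^+ 4 / tau ^+ 2); first by rewrite mulf_neq0 ?invr_eq0 ?expf_neq0.
split; apply: (mulIf tau20).
- by rewrite res k1E k2E k3E; field; rewrite tau0 u10 u20 u30.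
- have -> : cubD w = cubw w (div2 w - div3 w) (- (div1 w - div3 w)) by rewrite /cubD; congr (cubw _ _ _); ring.
  rewrite KE; apply: (etrans cD); rewrite -/(Dlin w x1 y1) -/(Dlin w x2 y2) D1E D2E k1E k2E.
  by field; rewrite tau0 u10 u20.
- have -> : cubL w = cubw w (ev2 w - ev3 w) (- (ev1 w - ev3 w)) by rewrite /cubL; congr (cubw _ _ _); ring.
  rewrite KE; apply: (etrans cL).
  have LE x y : (ev1 w - ev3 w) * x + (ev2 w - ev3 w) * y = Lin w x y 0 by rewrite /Lin; ring.
  by rewrite !LE L1E L2E; field; rewrite tau0 u10 u20.
Qed.

End LineData.

Section LineData.
Variable C : numClosedFieldType.
Implicit Types w : nform C.

Lemma nfmx_line_data w (a : 'I_3 -> 'rV[C]_3) : holo (nfmx w) ->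
  (forall p, is_fixed (nfmx w) p -> dI (nfmx w) p != 0) ->
  line_fixed_enum (nfmx w) a ->
  let r j := vI (nfmx w) (a j) / uI (nfmx w) (a j) in
  let s j := (1 - vI (nfmx w) (a j)) / uI (nfmx w) (a j) in
  exists2 g, g != 0 &
  [/\ lam1 w * lam2 w * lam3 w * area w ^+ 2 = g * (r i0 * r i1 * r i2),
      cubD w = g * ((3%:R * r i0 - 1) * (3%:R * r i1 - 1)
                    * (3%:R * r i0 + 3%:R * r i1 - 2%:R))
    & cubL w = g * (s i0 * s i1 * (s i0 + s i1))].
Proof.
move=> hh hd [fa ainj _] /=.
pose x j := co (a j) i0; pose y j := co (a j) i1.
have aE j : a j = r3 (x j) (y j) 0 by rewrite [LHS]r3E (fa j).2.
have n0 j : r3 (x j) (y j) 0 != 0 by rewrite -aE; case: (fa j) => -[].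
have det0 i j : i != j -> x i * y j - x j * y i != 0.
  move=> ij; apply: contra_neq ij => d0; apply: ainj; rewrite (aE i) (aE j).
  exact: planar_same_point (n0 i) (n0 j) d0.
have mult j := nfmx_line_mult hh hd (eq_ind _ (is_fixed (nfmx w)) (fa j).1 _ (aE j)).
have [k1 [e1 n1 u1 ve1 ue1]] := mult i0; have [k2 [e2 n2 u2 ve2 ue2]] := mult i1.
have [k3 [e3 n3 u3 ve3 ue3]] := mult i2.
rewrite -!aE in u1 ve1 ue1 u2 ve2 ue2 u3 ve3 ue3.
have dt0 : x i0 * y i1 - x i1 * y i0 != 0 by rewrite det0 // ord3_eqF.
have dt1 : x i2 * y i1 - x i1 * y i2 != 0 by rewrite det0 // ord3_eqF.
have dt2 : x i0 * y i2 - x i2 * y i0 != 0 by rewrite det0 // ord3_eqF.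
(* Cramer's rule: the first two eigenvectors are rescaled so that their sum is the third. Distinct
   fixed points make both factors nonzero. *)
pose c := (x i2 * y i1 - x i1 * y i2) / (x i0 * y i1 - x i1 * y i0).
pose d := (x i0 * y i2 - x i2 * y i0) / (x i0 * y i1 - x i1 * y i0).
have c0 : c != 0 by rewrite mulf_neq0 ?invr_eq0.
have d0 : d != 0 by rewrite mulf_neq0 ?invr_eq0.
have x3E : c * x i0 + d * x i1 = x i2 by rewrite /c /d; field.
have y3E : c * y i0 + d * y i1 = y i2 by rewrite /c /d; field.
have X1s k u v : vfx w (k * u) (k * v) 0 = k ^+ 2 * vfx w u v 0 by rewrite /vfx; ring.
have X2s k u v : vfy w (k * u) (k * v) 0 = k ^+ 2 * vfy w u v 0 by rewrite /vfy; ring.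
have Ls k u v : Lin w (k * u) (k * v) 0 = k * Lin w u v 0 by rewrite /Lin; ring.
have Ds k u v : Dlin w (k * u) (k * v) = k * Dlin w u v by rewrite /Dlin; ring.
apply: (@eigenframe_line_data _ w (c * x i0) (c * y i0) (d * x i1) (d * y i1)
  (c * k1) (d * k2) k3); rewrite ?x3E ?y3E ?X1s ?X2s ?Ls ?Ds -?mulrDr //.
- have -> : c * x i0 * (d * y i1) - d * x i1 * (c * y i0)
     = c * d * (x i0 * y i1 - x i1 * y i0) by ring.
  by rewrite mulf_neq0 ?dt0 ?(mulf_neq0 c0 d0).
- by case: e1 => -> ->; split; ring.
- by case: e2 => -> ->; split; ring.
- by rewrite mulf_neq0.
- by rewrite mulrCA ve1.
- by rewrite mulrCA ue1; ring.
- by rewrite mulrCA ve2.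
- by rewrite mulrCA ue2; ring.
Qed.

Lemma same_line_mults_invariants w w' : holo (nfmx w) -> holo (nfmx w') ->
  (forall p, is_fixed (nfmx w) p -> dI (nfmx w) p != 0) ->
  (forall p, is_fixed (nfmx w') p -> dI (nfmx w') p != 0) ->
  same_line_mults (nfmx w) (nfmx w') ->
  exists rho,
  [/\ lam1 w' * lam2 w' * lam3 w' * area w' ^+ 2
        = rho * (lam1 w * lam2 w * lam3 w * area w ^+ 2),
      cubD w' = rho * cubD w & cubL w' = rho * cubL w].
Proof.
move=> hw hw' dw dw' [a [b [fa fb uv]]].
have [g g0 [-> -> ->]] := nfmx_line_data hw dw fa.
have [g' g0' [-> -> ->]] := nfmx_line_data hw' dw' fb.
have u j := (uv j).1; have v j := (uv j).2.
by exists (g' / g); rewrite -!u -!v; split; rewrite [RHS]mulrA divfK.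
Qed.

End LineData.

Section Reduction.
Variable C : numClosedFieldType.
Implicit Types (e : nat -> C) (F : 'M[C]_(3, 6)) (ps : 'I_4 -> 'rV[C]_3).

(** * Reduction to the normal form *)

(* [e] lists the coordinates of a marked map as in [coords]: [e (6 * k + m)] are the
   coefficients, and [e (18 + 3 * i)] onwards those of the i-th marked point. *)
Definition px e i := e (18 + 3 * i)%N / e (20 + 3 * i)%N.
Definition py e i := e (19 + 3 * i)%N / e (20 + 3 * i)%N.
(** The third component of a map preserving the line is x_2 times a linear form L. At a fixed point
    normalized to x_2 = 1, the value of L is also the eigenvalue. *)
Definition mult_at e i := e 16%N * px e i + e 17%N * py e i + e 14%N.
(* The polarization of the k-th component of the map, at the i-th and j-th marked
   points in affine coordinates. *)
Definition polar e k i j :=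
  2%:R * e (6 * k)%N * px e i * px e j + 2%:R * e (6 * k).+1 * py e i * py e j
  + 2%:R * e (6 * k).+2 + e (6 * k).+3 * (px e i * py e j + px e j * py e i)
  + e (6 * k).+4 * (px e i + px e j) + e (6 * k + 5)%N * (py e i + py e j).
Definition frame_det e :=
  (px e 0 - px e 2) * (py e 1 - py e 2) - (px e 1 - px e 2) * (py e 0 - py e 2).
Definition coord1 e vx vy := (vx * (py e 1 - py e 2) - (px e 1 - px e 2) * vy) / frame_det e.
Definition coord2 e vx vy := ((px e 0 - px e 2) * vy - vx * (py e 0 - py e 2)) / frame_det e.
Definition defect_x e i j := polar e 0 i j - mult_at e j * px e i - mult_at e i * px e j.
Definition defect_y e i j := polar e 1 i j - mult_at e j * py e i - mult_at e i * py e j.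

Definition e_lam1 e := coord1 e (px e 3 - px e 2) (py e 3 - py e 2).
Definition e_lam2 e := coord2 e (px e 3 - px e 2) (py e 3 - py e 2).
(** Division by the value at the fourth point achieves [ev4 = 1]; X receives the same scaling in
    [e_a1] and the definitions after it. *)
Definition e_l e i := mult_at e i / mult_at e 3.
Definition e_a1 e := coord1 e (defect_x e 1 2) (defect_y e 1 2) / (e_lam1 e * mult_at e 3).
Definition e_a2 e := coord2 e (defect_x e 1 2) (defect_y e 1 2) / (e_lam1 e * mult_at e 3).
Definition e_b1 e := coord1 e (defect_x e 0 2) (defect_y e 0 2) / (e_lam2 e * mult_at e 3).
Definition e_b2 e := coord2 e (defect_x e 0 2) (defect_y e 0 2) / (e_lam2 e * mult_at e 3).

Definition nf_of e : nform C :=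
  NForm (e_lam1 e) (e_lam2 e) (e_l e 0) (e_l e 1) (e_l e 2) (e_a1 e) (e_a2 e) (e_b1 e) (e_b2 e).

Definition frame e : 'M[C]_3 := \matrix_(i < 3, j < 3) nth 0 (nth [::]
  [:: [:: px e 0 - px e 2; py e 0 - py e 2; 0];
      [:: px e 1 - px e 2; py e 1 - py e 2; 0];
      [:: px e 2; py e 2; 1]] i) j.

Lemma co_frame e x y z : r3 x y z *m frame e =
  r3 (x * (px e 0 - px e 2) + y * (px e 1 - px e 2) + z * px e 2)
     (x * (py e 0 - py e 2) + y * (py e 1 - py e 2) + z * py e 2) z.
Proof.
by apply: rv3P; rewrite co_mulmx !co_r3 !mxE !inordK //= ; ring.
Qed.

Lemma frame_unit e : frame_det e != 0 -> frame e \in unitmx.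
Proof.
move=> d0; rewrite unitmxE det_ord3 !mxE !inordK //= unitfE.
by move: d0; rewrite /frame_det; apply: contra_neq => <-; ring.
Qed.

Lemma frame_preserves_line e : preserves_line (frame e).
Proof. by split; rewrite !mxE !inordK //= oner_neq0. Qed.

Section QuadraticInterpolation.
Variables (c0 c1 c2 c3 c4 c5 : C) (x0 y0 x1 y1 x2 y2 x3 y3 u v : C).
(** Applied twice: [n] holds the values of L at the marked points and ([base_form], [w1], [w2],
    [w3]) their abscissas, then their ordinates. Here [base_form] is a scalar, the value at the
    first point. *)
Variables (n0 n1 n2 n3 base_form w1 w2 w3 : C).
Let q x y z := c0 * x ^+ 2 + c1 * y ^+ 2 + c2 * z ^+ 2 + c3 * (x * y) + c4 * (x * z) + c5 * (y * z).
Let b x y x' y' := 2%:R * c0 * x * x' + 2%:R * c1 * y * y'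
  + 2%:R * c2 + c3 * (x * y' + x' * y) + c4 * (x + x') + c5 * (y + y').
Let s := 1 - u - v.
Let A' := b x1 y1 x2 y2 - n2 * w1 - n1 * w2.
Let B' := b x0 y0 x2 y2 - n2 * base_form - n0 * w2.
Hypotheses (x3E : x3 = u * x0 + v * x1 + s * x2) (y3E : y3 = u * y0 + v * y1 + s * y2)
  (w3E : w3 = u * base_form + v * w1 + s * w2) (n3E : n3 = u * n0 + v * n1 + s * n2).
Hypotheses (q0 : q x0 y0 1 = n0 * base_form) (q1 : q x1 y1 1 = n1 * w1)
  (q2 : q x2 y2 1 = n2 * w2) (q3 : q x3 y3 1 = n3 * w3).

(* Subtracting from [q] the product of the two linear forms interpolating [n]
   and [w] leaves a combination of [yz], [xz], [xy], whose last coefficient is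
   given by the vanishing at the fourth point. *)
Lemma quadratic_interpolation (x y z : C) : u != 0 -> v != 0 ->
  let t := z - x - y in
  q (x * x0 + y * x1 + t * x2) (x * y0 + y * y1 + t * y2) z =
  (x * base_form + y * w1 + t * w2) * (x * n0 + y * n1 + t * n2)
  + A' * y * t + B' * x * t - (s * (A' / u) + s * (B' / v)) * x * y.
Proof.
move=> u0 v0 t.
pose C' := b x0 y0 x1 y1 - n0 * w1 - n1 * base_form.
have exp x' y' t' : q (x' * x0 + y' * x1 + t' * x2) (x' * y0 + y' * y1 + t' * y2) (x' + y' + t') =
  (x' * base_form + y' * w1 + t' * w2) * (x' * n0 + y' * n1 + t' * n2)
  + A' * y' * t' + B' * x' * t' + C' * x' * y'.
  apply: etrans (_ : x' ^+ 2 * q x0 y0 1 + y' ^+ 2 * q x1 y1 1 + t' ^+ 2 * q x2 y2 1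
    + b x1 y1 x2 y2 * y' * t' + b x0 y0 x2 y2 * x' * t' + b x0 y0 x1 y1 * x' * y' = _).
    by rewrite /q /b; ring.
  by rewrite q0 q1 q2 /A' /B' /C'; ring.
have C'E : C' = - (s * (A' / u) + s * (B' / v)).
  have := exp u v s; rewrite -x3E -y3E -w3E -n3E.
  have -> : u + v + s = 1 by rewrite /s; ring.
  rewrite q3 mulrC -[LHS]addr0 -!addrA => /addrI e0.
  have {}e0 : C' * (u * v) = - (A' * v * s + B' * u * s) by apply/eqP; rewrite -addr_eq0 e0; apply/eqP; ring.
  have -> : C' = C' * (u * v) / (u * v) by field; rewrite u0 v0.
  by rewrite e0; field; rewrite u0 v0.
have {1}-> : z = x + y + t by rewrite /t; ring.
by rewrite exp C'E; ring.
Qed.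
End QuadraticInterpolation.

Lemma coordsE F ps (e := coords F ps) :
  ((e 0%N = F i0 (inord 0)) * (e 1%N = F i0 (inord 1)) * (e 2%N = F i0 (inord 2)) *
   (e 3%N = F i0 (inord 3)) * (e 4%N = F i0 (inord 4)) * (e 5%N = F i0 (inord 5)) *
   (e 6%N = F i1 (inord 0)) * (e 7%N = F i1 (inord 1)) * (e 8%N = F i1 (inord 2)) *
   (e 9%N = F i1 (inord 3)) * (e 10%N = F i1 (inord 4)) * (e 11%N = F i1 (inord 5)) *
   (e 14%N = F i2 (inord 2)) * (e 16%N = F i2 (inord 4)) * (e 17%N = F i2 (inord 5)))%type.
Proof. by []. Qed.

Lemma coords_pt F ps i : (i < 4)%N ->
  [/\ coords F ps (18 + 3 * i) = co (ps (inord i)) i0,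
      coords F ps (19 + 3 * i) = co (ps (inord i)) i1
    & coords F ps (20 + 3 * i) = co (ps (inord i)) i2].
Proof. by case: i => [|[|[|[|//]]]]. Qed.

End Reduction.

Section Reduction.
Variable C : numClosedFieldType.
Implicit Types (e : nat -> C) (F : 'M[C]_(3, 6)) (ps : 'I_4 -> 'rV[C]_3).

Definition npt e i : 'rV[C]_3 := r3 (px e i) (py e i) 1.

Lemma ps_npt F ps i : (i < 4)%N -> co (ps (inord i)) i2 != 0 ->
  ps (inord i) = co (ps (inord i)) i2 *: npt (coords F ps) i.
Proof.
move=> i4 p2; have [e0 e1 e2] := coords_pt F ps i4.
by apply: rv3P; rewrite co_scale !co_r3 /px /py ?e0 ?e1 ?e2 ?mulr1 // mulrC divfK.
Qed.

Lemma npt_eigen F ps i : inv_line F -> (i < 4)%N ->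
  is_fixed F (ps (inord i)) -> co (ps (inord i)) i2 != 0 ->
  qeval F (npt (coords F ps) i) = mult_at (coords F ps) i *: npt (coords F ps) i.
Proof.
move=> Fl i4 [_ [lam Fp]] p2; set e := coords F ps.
have [c0 c1 c3] := inv_line_coef Fl.
have [k Fn] : exists k, qeval F (npt e i) = k *: npt e i.
  exists (lam / co (ps (inord i)) i2).
  have -> : npt e i = (co (ps (inord i)) i2)^-1 *: ps (inord i).
    by rewrite [X in _ *: X](ps_npt F i4 p2) scalerA mulVf ?scale1r.
  by rewrite qeval_scale Fp !scalerA; congr (_ *: _); field.
suff -> : mult_at e i = k by [].
have := congr1 (fun v => co v i2) Fn.
rewrite co_scale co_qeval !co_r3 c0 c1 c3 => h.
apply: etrans (_ : k * 1 = _); last by ring.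
by rewrite -h /mult_at /e !coordsE; ring.
Qed.

Lemma reduction F ps (e := coords F ps) : inv_line F ->
  (forall i, is_fixed F (ps i) /\ co (ps i) i2 != 0) ->
  frame_det e != 0 -> lam1 (nf_of e) != 0 -> lam2 (nf_of e) != 0 -> mult_at e 3 != 0 ->
  conjugates (mult_at e 3) (frame e) F (nfmx (nf_of e)).
Proof.
move=> Fl fix4 det0 lam10 lam20 n30; split=> //; first exact: frame_unit.
have eig i : (i < 4)%N -> qeval F (npt e i) = mult_at e i *: npt e i.
  by move=> i4; have [fp p2] := fix4 (inord i); apply: npt_eigen.
have [c0 c1 c3] := inv_line_coef Fl.
have eigx i : (i < 4)%N -> co (qeval F (npt e i)) i0 = mult_at e i * px e i.
  by move/eig->; rewrite co_scale co_r3.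
have eigy i : (i < 4)%N -> co (qeval F (npt e i)) i1 = mult_at e i * py e i.
  by move/eig->; rewrite co_scale co_r3.
set w := nf_of e.
have x3E : px e 3 = lam1 w * px e 0 + lam2 w * px e 1 + (1 - lam1 w - lam2 w) * px e 2.
  by move: det0; rewrite /= /e_lam1 /e_lam2 /coord1 /coord2 /frame_det => det0; field.
have y3E : py e 3 = lam1 w * py e 0 + lam2 w * py e 1 + (1 - lam1 w - lam2 w) * py e 2.
  by move: det0; rewrite /= /e_lam1 /e_lam2 /coord1 /coord2 /frame_det => det0; field.
have n3E : mult_at e 3 = lam1 w * mult_at e 0 + lam2 w * mult_at e 1
    + (1 - lam1 w - lam2 w) * mult_at e 2.
  by rewrite [LHS]/mult_at x3E y3E /mult_at; ring.
have l1E : mult_at e 0 = mult_at e 3 * ev1 w by rewrite /= /e_l; field.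
have l2E : mult_at e 1 = mult_at e 3 * ev2 w by rewrite /= /e_l; field.
have l3E : mult_at e 2 = mult_at e 3 * ev3 w by rewrite /= /e_l; field.
have coordK vx vy : vx = coord1 e vx vy * (px e 0 - px e 2) + coord2 e vx vy * (px e 1 - px e 2)
  /\ vy = coord1 e vx vy * (py e 0 - py e 2) + coord2 e vx vy * (py e 1 - py e 2).
  by move: det0; rewrite /coord1 /coord2 /frame_det => det0; split; field.
(* The defects along the edges p2 p3 and p1 p3 are the coefficients of y2 y3 and y1 y3 in X; in the
   frame of the first three points they give the vectors a and b. *)
have [ax ay] := coordK (defect_x e 1 2) (defect_y e 1 2).
have [bx by_] := coordK (defect_x e 0 2) (defect_y e 0 2).
have a1E : coord1 e (defect_x e 1 2) (defect_y e 1 2) = lam1 w * mult_at e 3 * a1 w.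
  by rewrite [a1 w]/(_ / _) mulrC divfK // mulf_neq0.
have a2E : coord2 e (defect_x e 1 2) (defect_y e 1 2) = lam1 w * mult_at e 3 * a2 w.
  by rewrite [a2 w]/(_ / _) mulrC divfK // mulf_neq0.
have b1E : coord1 e (defect_x e 0 2) (defect_y e 0 2) = lam2 w * mult_at e 3 * b1 w.
  by rewrite [b1 w]/(_ / _) mulrC divfK // mulf_neq0.
have b2E : coord2 e (defect_x e 0 2) (defect_y e 0 2) = lam2 w * mult_at e 3 * b2 w.
  by rewrite [b2 w]/(_ / _) mulrC divfK // mulf_neq0.
rewrite a1E a2E in ax ay; rewrite b1E b2E in bx by_.
move=> X; rewrite (r3E X); move: (co X i0) (co X i1) (co X i2) => x y z.
rewrite qeval_nfmx !co_frame.
have qc k : co (qeval F (npt e k)) i0 = F i0 (inord 0) * px e k ^+ 2 + F i0 (inord 1) * py e k ^+ 2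
  + F i0 (inord 2) * 1 ^+ 2 + F i0 (inord 3) * (px e k * py e k)
  + F i0 (inord 4) * (px e k * 1) + F i0 (inord 5) * (py e k * 1).
  by rewrite co_qeval !co_r3.
have qc' k : co (qeval F (npt e k)) i1 = F i1 (inord 0) * px e k ^+ 2 + F i1 (inord 1) * py e k ^+ 2
  + F i1 (inord 2) * 1 ^+ 2 + F i1 (inord 3) * (px e k * py e k)
  + F i1 (inord 4) * (px e k * 1) + F i1 (inord 5) * (py e k * 1).
  by rewrite co_qeval !co_r3.
have Qx := quadratic_interpolation x3E y3E x3E n3E
  (etrans (esym (qc 0)) (eigx 0 isT)) (etrans (esym (qc 1)) (eigx 1 isT))
  (etrans (esym (qc 2)) (eigx 2 isT)) (etrans (esym (qc 3)) (eigx 3 isT))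
  x y z lam10 lam20.
have Qy := quadratic_interpolation x3E y3E y3E n3E
  (etrans (esym (qc' 0)) (eigy 0 isT)) (etrans (esym (qc' 1)) (eigy 1 isT))
  (etrans (esym (qc' 2)) (eigy 2 isT)) (etrans (esym (qc' 3)) (eigy 3 isT))
  x y z lam10 lam20.
set t := z - x - y in Qx Qy.
have XE : x * (px e 0 - px e 2) + y * (px e 1 - px e 2) + z * px e 2
   = x * px e 0 + y * px e 1 + t * px e 2 by rewrite /t; ring.
have YE : x * (py e 0 - py e 2) + y * (py e 1 - py e 2) + z * py e 2
   = x * py e 0 + y * py e 1 + t * py e 2 by rewrite /t; ring.
rewrite XE YE.
have LE : x * mult_at e 0 + y * mult_at e 1 + t * mult_at e 2 = mult_at e 3 * Lin w x y z.
  by rewrite l1E l2E l3E /Lin /t; ring.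
apply: rv3P; rewrite co_scale !co_r3.
- have -> : co (qeval F (r3 (x * px e 0 + y * px e 1 + t * px e 2)
                            (x * py e 0 + y * py e 1 + t * py e 2) z)) i0
    = (x * px e 0 + y * px e 1 + t * px e 2)
      * (x * mult_at e 0 + y * mult_at e 1 + t * mult_at e 2)
      + defect_x e 1 2 * y * t + defect_x e 0 2 * x * t
      - (lam3 w * (defect_x e 1 2 / lam1 w) + lam3 w * (defect_x e 0 2 / lam2 w)) * x * y.
    by rewrite co_qeval !co_r3; exact: Qx.
  rewrite ax bx LE -XE /vfx /vfy -/t.
  by field; rewrite lam10 lam20.
- have -> : co (qeval F (r3 (x * px e 0 + y * px e 1 + t * px e 2)
                            (x * py e 0 + y * py e 1 + t * py e 2) z)) i1
    = (x * py e 0 + y * py e 1 + t * py e 2)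
      * (x * mult_at e 0 + y * mult_at e 1 + t * mult_at e 2)
      + defect_y e 1 2 * y * t + defect_y e 0 2 * x * t
      - (lam3 w * (defect_y e 1 2 / lam1 w) + lam3 w * (defect_y e 0 2 / lam2 w)) * x * y.
    by rewrite co_qeval !co_r3; exact: Qy.
  rewrite ay by_ LE -YE /vfx /vfy -/t.
  by field; rewrite lam10 lam20.
- have -> : mult_at e 3 * (z * Lin w x y z)
    = z * (x * mult_at e 0 + y * mult_at e 1 + t * mult_at e 2) by rewrite LE; ring.
  rewrite co_qeval !co_r3 c0 c1 c3 /mult_at /e !coordsE.
  by rewrite /t; ring.
Qed.

Lemma frame_pt e : [/\ pt1 C *m frame e = npt e 0, pt2 C *m frame e = npt e 1
  & pt3 C *m frame e = npt e 2].
Proof. by split; rewrite co_frame; apply: rv3P; rewrite !co_r3; ring. Qed.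

Lemma frame_pt4 e : frame_det e != 0 -> pt4 (nf_of e) *m frame e = npt e 3.
Proof.
move=> det0; rewrite co_frame; apply: rv3P; rewrite !co_r3 //=;
  rewrite /e_lam1 /e_lam2 /coord1 /coord2; move: det0; rewrite /frame_det => det0; by field.
Qed.

Lemma l4_nf_of e : frame_det e != 0 -> mult_at e 3 != 0 -> ev4 (nf_of e) = 1.
Proof.
move=> det0 m0; rewrite /ev4 /lam3 /= /e_l.
have n3E : mult_at e 3 = e_lam1 e * mult_at e 0 + e_lam2 e * mult_at e 1
    + (1 - e_lam1 e - e_lam2 e) * mult_at e 2.
  rewrite /e_lam1 /e_lam2 /coord1 /coord2 /mult_at; move: det0; rewrite /frame_det => det0.
  by field.
by apply: (mulIf m0); rewrite mul1r [RHS]n3E; field.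
Qed.

End Reduction.

(** * An explicit map with rational fixed points *)

Section BasePoint.
Variable C : numClosedFieldType.
Implicit Types w : nform C.

Definition std_pts w (i : 'I_4) : 'rV[C]_3 := nth 0 [:: pt1 C; pt2 C; pt3 C; pt4 w] i.

Lemma std_ptsE w : ((std_pts w (inord 0) = pt1 C) * (std_pts w (inord 1) = pt2 C)
  * (std_pts w (inord 2) = pt3 C) * (std_pts w (inord 3) = pt4 w))%type.
Proof. by rewrite /std_pts !inordK. Qed.

Lemma ord4_cases (i : 'I_4) : [\/ i = inord 0, i = inord 1, i = inord 2 | i = inord 3].
Proof.
case: i => [[|[|[|[|//]]]] hi]; [constructor 1|constructor 2|constructor 3|constructor 4];
  by apply: val_inj; rewrite /= inordK.
Qed.

Lemma std_coords w (e := coords (nfmx w) (std_pts w)) :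
  ((px e 0 = 1) * (py e 0 = 0) * (px e 1 = 0) * (py e 1 = 1) * (px e 2 = 0) * (py e 2 = 0)
   * (px e 3 = lam1 w) * (py e 3 = lam2 w))%type.
Proof.
have E i (i4 : (i < 4)%N) := coords_pt (nfmx w) (std_pts w) i4.
have [a0 b0 c0] := E 0 isT; have [a1 b1 c1] := E 1 isT.
have [a2 b2 c2] := E 2 isT; have [a3 b3 c3] := E 3 isT.
by rewrite /px /py /e a0 b0 c0 a1 b1 c1 a2 b2 c2 a3 b3 c3 !std_ptsE !co_r3 !divr1.
Qed.

(** Reduces the evaluation of the genericity conditions at the explicit map to the nine numbers of
    its normal form. *)
Lemma nf_of_std w : ev4 w = 1 -> lam1 w != 0 -> lam2 w != 0 ->
  nf_of (coords (nfmx w) (std_pts w)) = w.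
Proof.
move=> l41 p0 q0; set e := coords _ _.
have det1 : frame_det e = 1 by rewrite /frame_det !std_coords; ring.
have c1E vx vy : coord1 e vx vy = vx by rewrite /coord1 det1 !std_coords; field.
have c2E vx vy : coord2 e vx vy = vy by rewrite /coord2 det1 !std_coords; field.
have m0E : mult_at e 0 = ev1 w.
  by rewrite /mult_at !std_coords /e !coordsE !nfmxE; ring.
have m1E : mult_at e 1 = ev2 w.
  by rewrite /mult_at !std_coords /e !coordsE !nfmxE; ring.
have m2E : mult_at e 2 = ev3 w.
  by rewrite /mult_at !std_coords /e !coordsE !nfmxE; ring.
have m3E : mult_at e 3 = 1.
  by rewrite -l41 /mult_at !std_coords /e !coordsE !nfmxE /ev4 /lam3; ring.
have x12 : defect_x e 1 2 = lam1 w * a1 w.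
  by rewrite /defect_x /polar m1E m2E !std_coords /e !coordsE !nfmxE; ring.
have y12 : defect_y e 1 2 = lam1 w * a2 w.
  by rewrite /defect_y /polar m1E m2E !std_coords /e !coordsE !nfmxE; ring.
have x02 : defect_x e 0 2 = lam2 w * b1 w.
  by rewrite /defect_x /polar m0E m2E !std_coords /e !coordsE !nfmxE; ring.
have y02 : defect_y e 0 2 = lam2 w * b2 w.
  by rewrite /defect_y /polar m0E m2E !std_coords /e !coordsE !nfmxE; ring.
have l1E : e_lam1 e = lam1 w by rewrite /e_lam1 c1E !std_coords subr0.
have l2E : e_lam2 e = lam2 w by rewrite /e_lam2 c2E !std_coords subr0.
rewrite /nf_of /e_l /e_a1 /e_a2 /e_b1 /e_b2 !c1E !c2E x12 y12 x02 y02 l1E l2E m0E m1E m2E m3E.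
by apply: nform_eq => /=; rewrite ?divr1 ?mulr1 //; field.
Qed.

(* Chosen so that its fixed points on the line, and the second solution
   [(1/2, -1/2, -1)] for the inverse values of L, are rational. *)
Definition base_form : nform C := NForm 2%:R (- 2%:R) (-1) (-1) 1 (-1) 2%:R (- 2%:R) 1.

Lemma base_form_values :
  ((lam3 base_form = 1) * (ev4 base_form = 1) * (area base_form = 3%:R)
   * (div1 base_form = - 5%:R) * (div2 base_form = 1) * (div3 base_form = 8%:R))%type.
Proof.
rewrite /ev4 /div1 /div2 /div3 /area /lam3 /=; do !split; ring.
Qed.

Lemma base_form_mult :
  ((mtr1 base_form = - 5%:R) * (mtr2 base_form = 1) * (mtr3 base_form = - 8%:R) * (mdet1 base_form = 6%:R) * (mdet2 base_form = - 6%:R)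
  * (mdet3 base_form = 12%:R) * (mdet4 base_form = - 12%:R))%type.
Proof.
by rewrite /mtr1 /mtr2 /mtr3 /mdet1 /mdet2 /mdet3 /mdet4 !base_form_values /=; do !split; field.
Qed.

Lemma base_form_Th : theta_sq base_form = 864%:R.
Proof. by rewrite /theta_sq /theta1 /theta2 /theta3 !base_form_mult; ring. Qed.

Lemma base_form_m : ((alt_inv_ev1 base_form = 2%:R^-1) * (alt_inv_ev2 base_form = - 2%:R^-1) * (alt_inv_ev3 base_form = -1))%type.
Proof.
by rewrite /alt_inv_ev1 /alt_inv_ev2 /alt_inv_ev3 /theta_pairing base_form_Th /theta1 /theta2 /theta3 !base_form_mult /=; do !split; field.
Qed.

Lemma base_form_mu : ((alt_lam1 base_form = 2%:R^-1) * (alt_lam2 base_form = - 2%:R^-1) * (alt_lam3 base_form = 1))%type.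
Proof. by rewrite /alt_lam1 /alt_lam2 /alt_lam3 !base_form_mult !base_form_m; do !split; field. Qed.

Lemma base_form_cubD_slope : cubD_slope base_form = - 432%:R.
Proof.
by rewrite /cubD_slope !base_form_values /cub_sol /sol_a1 /sol_b2 /sol_b1 /cub /=; field.
Qed.

(** [cubL] vanishes because the zero (-1 : 1 : 0) of L on the line is itself a fixed point of this
    map. *)
Lemma base_form_cubics : ((cubD base_form = 198%:R) * (cubL base_form = 0))%type.
Proof. by rewrite /cubD /cubL /cubw /cub !base_form_values /=; split; ring. Qed.

Lemma base_form_alt : ((alt_cubL base_form 0 0 0 1 = 32%:R) * (alt_cubD base_form 0 0 0 1 = 256%:R))%type.
Proof.
rewrite /alt_cubD /alt_cubL /alt_mdiv1 /alt_mdiv2 /alt_mdiv3 !base_form_mult !base_form_m !base_form_mu.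
by rewrite /cub_sol /sol_a1 /sol_b2 /sol_b1 /cub /=; split; field.
Qed.

Lemma base_form_f : ((alt_mdiv1 base_form = - 10%:R) * (alt_mdiv2 base_form = - 2%:R) * (alt_mdiv3 base_form = 8%:R))%type.
Proof. by rewrite /alt_mdiv1 /alt_mdiv2 /alt_mdiv3 !base_form_mult !base_form_m; do !split; field. Qed.

Lemma base_form_alt0 : ((alt_cubL base_form (- alt_mdiv1 base_form) (- alt_mdiv2 base_form) (- alt_mdiv3 base_form) 0 = 272%:R)
  * (alt_cubD base_form (- alt_mdiv1 base_form) (- alt_mdiv2 base_form) (- alt_mdiv3 base_form) 0 = (128%:R * 89%:R)%R))%type.
Proof.
rewrite /alt_cubD /alt_cubL !base_form_f !base_form_m !base_form_mu.
by rewrite /cub_sol /sol_a1 /sol_b2 /sol_b1 /cub /=; split; field.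
Qed.

(** [ratio] is 16 here, so the value is 32 (16 * 198 - 128 * 89) + 256 * 272. *)
Lemma base_form_Psi : alt_obstruction base_form = - (512%:R * 378%:R).
Proof.
rewrite /alt_obstruction !base_form_alt !base_form_alt0 !base_form_cubics /ratio !base_form_mu base_form_values /=.
by field.
Qed.
End BasePoint.

(** * The fixed points of the explicit map *)

Section BasePoint.
Variable C : numClosedFieldType.

Notation F0 := (nfmx (base_form C)).

Definition ln1 : 'rV[C]_3 := r3 (-1) 1 0.
Definition ln2 : 'rV[C]_3 := r3 (-1) 2%:R 0.
Definition ln3 : 'rV[C]_3 := r3 2%:R 1 0.

Lemma tI_dI_scale (F : 'M[C]_(3, 6)) p lam c : p != 0 -> lam != 0 -> c != 0 ->
  qeval F p = lam *: p -> tI F (c *: p) = tI F p /\ dI F (c *: p) = dI F p.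
Proof.
move=> p0 lam0 c0 Fp.
have cp0 : c *: p != 0 by rewrite scaler_eq0 negb_or c0.
have cl0 : c * lam != 0 by rewrite mulf_neq0.
have Fcp : qeval F (c *: p) = (c * lam) *: (c *: p).
  by rewrite qeval_scale Fp !scalerA; congr (_ *: _); ring.
have [-> ->] := fixed_tI_dI cp0 cl0 Fcp; have [-> ->] := fixed_tI_dI p0 lam0 Fp.
rewrite JF_scale mxtraceZ -mulf_div divff // mul1r scalerA.
have -> : (c * lam)^-1 * c = lam^-1 by rewrite invfM mulrAC mulVf // mul1r.
by [].
Qed.

Lemma base_form_qeval x y z : let t := z - x - y in let L := z - 2%:R * x - 2%:R * y in
  qeval F0 (r3 x y z) =
  r3 (x * L - 2%:R * y * t + 4%:R * x * t + 3%:R * x * y)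
     (y * L + 4%:R * y * t - 2%:R * x * t - 3%:R * x * y) (z * L).
Proof.
by rewrite qeval_nfmx /Lin /vfx /vfy /lam3 /=; apply: rv3P; rewrite !co_r3; ring.
Qed.

Lemma base_form_ln_eigen : [/\ qeval F0 ln1 = 3%:R *: ln1, qeval F0 ln2 = (- 4%:R) *: ln2
  & qeval F0 ln3 = (- 12%:R) *: ln3].
Proof. by split; rewrite base_form_qeval; apply: rv3P; rewrite co_scale !co_r3; ring. Qed.

Lemma ln_neq0 : [/\ ln1 != 0, ln2 != 0 & ln3 != 0].
Proof.
split; apply/eqP=> /(congr1 (fun v => co v i1)); rewrite co_r3 co0 => /eqP;
  by rewrite ?oner_eq0 ?pnatr_eq0.
Qed.

Lemma base_form_ln_dI : [/\ dI F0 ln1 != 0, dI F0 ln2 != 0 & dI F0 ln3 != 0].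
Proof.
have [e1 e2 e3] := base_form_ln_eigen; have [n1 n2 n3] := ln_neq0.
have c3 : (3%:R : C) != 0 by rewrite pnatr_eq0.
have c4 : (- 4%:R : C) != 0 by rewrite oppr_eq0 pnatr_eq0.
have c12 : (- 12%:R : C) != 0 by rewrite oppr_eq0 pnatr_eq0.
have E i j (x : 'rV[C]_3) (c : C) : (c *: JF F0 x) i j = c * JF F0 x i j by rewrite mxE.
have vE (d c : C) : c != 0 -> d = c -> d != 0 by move=> ? ->.
have v8 : (5%:R / 8%:R : C) != 0 by rewrite mulf_neq0 ?invr_eq0 ?pnatr_eq0.
split.
- have [_ ->] := fixed_tI_dI n1 c3 e1; apply: (vE _ 1 (oner_neq0 _)).
  by rewrite det_ord3 !sub1mxE !E !ord3_eqF !eqxx !JF_E !co_r3 !nfmxE /lam3 /=; field.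
- have [_ ->] := fixed_tI_dI n2 c4 e2; apply: (vE _ _ v8).
  by rewrite det_ord3 !sub1mxE !E !ord3_eqF !eqxx !JF_E !co_r3 !nfmxE /lam3 /=; field.
- have [_ ->] := fixed_tI_dI n3 c12 e3; apply: (vE _ (- (5%:R / 8%:R))); first by rewrite oppr_eq0.
  by rewrite det_ord3 !sub1mxE !E !ord3_eqF !eqxx !JF_E !co_r3 !nfmxE /lam3 /=; field.
Qed.

Definition fixed_list : seq 'rV[C]_3 :=
  [:: pt1 C; pt2 C; pt3 C; pt4 (base_form C); ln1; ln2; ln3].

Lemma base_form_fixed_cases p mu : p != 0 -> qeval F0 p = mu *: p ->
  exists2 q, q \in fixed_list & same_point p q.
Proof.
rewrite (r3E p); move: (co p i0) (co p i1) (co p i2) => x y z p0.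
rewrite base_form_qeval => e.
have := (congr1 (fun v => co v i0) e, congr1 (fun v => co v i1) e, congr1 (fun v => co v i2) e).
rewrite !co_scale !co_r3 => -[[e0 e1] e2] {e}.
set t := z - x - y in e0 e1; set L := z - _ - _ in e0 e1 e2.
have [z0|z0] := eqVneq z 0.
  (* On the line the fixed points are the zeros of the cubic y ^ X(y), which splits over the
     rationals for this map. *)
  have c0 : (x + y) * (2%:R * x + y) * (x - 2%:R * y) = 0.
    apply: etrans (_ : x * (mu * y) - y * (mu * x) = _); last by ring.
    by rewrite -e0 -e1 /t /L z0; ring.
  have y0 : y != 0.
    apply: contra_neq p0 => y0; have x0 : x = 0.
      apply/eqP; move/eqP: c0; rewrite y0 mulr0 subr0 !addr0 !mulf_eq0 pnatr_eq0 /=.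
      by rewrite !orbb.
    by apply: rv3P; rewrite co_r3 co0.
  move/eqP: c0; rewrite !mulf_eq0 -orbA => /or3P[] /eqP h.
  - exists ln1; first by rewrite !inE eqxx !orbT.
    exists y; split=> //; have xE : x = - y by rewrite -[LHS]subr0 -h; ring.
    by apply: rv3P; rewrite co_scale !co_r3 ?xE ?z0; ring.
  - exists ln2; first by rewrite !inE eqxx !orbT.
    have yE : y = - (2%:R * x) by rewrite -[LHS]subr0 -h; ring.
    exists (- x); split.
      by rewrite oppr_eq0; apply: contra_neq y0 => x0; rewrite yE x0; ring.
    by apply: rv3P; rewrite co_scale !co_r3 ?yE ?z0; ring.
  - exists ln3; first by rewrite !inE eqxx !orbT.
    exists y; split=> //; have xE : x = 2%:R * y by rewrite -[LHS]subr0 -h; ring.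
    by apply: rv3P; rewrite co_scale !co_r3 ?xE ?z0; ring.
have muE : mu = L by apply: (mulfI z0); rewrite e2 mulrC.
rewrite muE in e0 e1.
have {}e0 : - 2%:R * y * t + 4%:R * x * t + 3%:R * x * y = 0.
  by apply: (addrI (x * L)); rewrite addr0 [RHS]mulrC -e0; ring.
have {}e1 : 4%:R * y * t - 2%:R * x * t - 3%:R * x * y = 0.
  by apply: (addrI (y * L)); rewrite addr0 [RHS]mulrC -e1; ring.
have c3 : (3%:R : C) != 0 by rewrite pnatr_eq0.
(* Off the line X vanishes. Suitable combinations of its components are the two degenerate conics y
   (2 t - x) and x (2 t + y), whose common points are the four marked ones. *)
have q1 : y * (2%:R * t - x) = 0.
  apply: (mulfI c3); rewrite mulr0.
  apply: etrans (_ : (- 2%:R * y * t + 4%:R * x * t + 3%:R * x * y)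
    + 2%:R * (4%:R * y * t - 2%:R * x * t - 3%:R * x * y) = _); first by ring.
  by rewrite e0 e1; ring.
have q2 : x * (2%:R * t + y) = 0.
  apply: (mulfI c3); rewrite mulr0.
  apply: etrans (_ : 2%:R * (- 2%:R * y * t + 4%:R * x * t + 3%:R * x * y)
    + (4%:R * y * t - 2%:R * x * t - 3%:R * x * y) = _); first by ring.
  by rewrite e0 e1; ring.
have tE : x = z - y - t by rewrite /t; ring.
move/eqP: q1; rewrite mulf_eq0 => /orP[] /eqP h1; move/eqP: q2; rewrite mulf_eq0 => /orP[] /eqP h2.
- exists (pt3 C); first by rewrite !inE eqxx !orbT.
  by exists z; split=> //; apply: rv3P; rewrite co_scale !co_r3 ?h1 ?h2; ring.
- exists (pt1 C); first by rewrite !inE eqxx.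
  exists z; split=> //.
  have t0 : t = 0.
    have c2 : (2%:R : C) != 0 by rewrite pnatr_eq0.
    by apply: (mulfI c2); rewrite mulr0 -h2 h1; ring.
  by apply: rv3P; rewrite co_scale !co_r3 ?tE ?h1 ?t0; ring.
- exists (pt2 C); first by rewrite !inE eqxx !orbT.
  exists z; split=> //.
  have t0 : t = 0.
    have c2 : (2%:R : C) != 0 by rewrite pnatr_eq0.
    by apply: (mulfI c2); rewrite mulr0 -h1 h2; ring.
  have yE : y = z.
    apply: etrans (_ : z - x - t = _); first by rewrite /t; ring.
    by rewrite h2 t0; ring.
  by apply: rv3P; rewrite co_scale !co_r3 ?yE ?h2; ring.
- exists (pt4 (base_form C)); first by rewrite !inE eqxx !orbT.
  exists z; split=> //.
  have x2t : x = 2%:R * t by rewrite -[LHS]addr0 -h1; ring.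
  have y2t : y = - (2%:R * t) by rewrite -[LHS]subr0 -h2; ring.
  have tz : t = z by rewrite {1}/t x2t y2t; ring.
  by apply: rv3P; rewrite co_scale !co_r3 ?x2t ?y2t ?tz /=; ring.
Qed.

End BasePoint.

(** * Membership of the explicit map in the marked family *)

Section BasePoint.
Variable C : numClosedFieldType.
Notation F0 := (nfmx (base_form C)).

Lemma base_form_fixed_list q : q \in fixed_list C ->
  [/\ q != 0, dI F0 q != 0 & exists2 lam, lam != 0 & qeval F0 q = lam *: q].
Proof.
have [n1 n2 n3] := ln_neq0 C; have [dl1 dl2 dl3] := base_form_ln_dI C.
have [e1 e2 e3] := base_form_ln_eigen C.
have c n : (n.+1%:R : C) != 0 by rewrite pnatr_eq0.
have cN n : (- n.+1%:R : C) != 0 by rewrite oppr_eq0.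
have c1 : (1 : C) != 0 by rewrite oner_neq0.
have cN1 : (-1 : C) != 0 by rewrite oppr_eq0.
have [_ dE1] := @nfmx_pt1_mult _ (base_form C) cN1; have [_ dE2] := @nfmx_pt2_mult _ (base_form C) cN1.
have [_ dE3] := @nfmx_pt3_mult _ (base_form C) c1.
have l41 : ev4 (base_form C) = 1 by rewrite !base_form_values.
have [_ dE4] := nfmx_pt4_mult l41.
rewrite !inE => /or4P[/eqP->|/eqP->|/eqP->|/or4P[/eqP->|/eqP->|/eqP->|/eqP->]].
- split; [exact: affine_neq0 | by rewrite dE1 !base_form_mult | exists (-1) => //; exact: nfmx_pt1].
- split; [exact: affine_neq0 | by rewrite dE2 !base_form_mult | exists (-1) => //; exact: nfmx_pt2].
- split; [exact: affine_neq0 | by rewrite dE3 !base_form_mult | exists 1 => //; exact: nfmx_pt3].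
- split; [exact: affine_neq0 | by rewrite dE4 !base_form_mult | exists 1 => //].
  by rewrite nfmx_pt4 l41.
- by split=> //; exists 3%:R.
- by split=> //; exists (- 4%:R).
- by split=> //; exists (- 12%:R).
Qed.

Lemma co_std_pts (i : 'I_4) : co (std_pts (base_form C) i) i2 = 1.
Proof. by case: (ord4_cases i) => ->; rewrite !std_ptsE co_r3. Qed.

Lemma std_pts_inj (i j : 'I_4) : std_pts (base_form C) i = std_pts (base_form C) j -> i = j.
Proof.
(* The form 3 x + y separates the marked points, with values 3, 1, 0, 4. *)
move=> /(congr1 (fun v => 3%:R * co v i0 + co v i1)).
have E k : 3%:R * co (std_pts (base_form C) k) i0 + co (std_pts (base_form C) k) i1
    = (nth 0 [:: 3; 1; 0; 4] k)%N%:R.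
  by case: (ord4_cases k) => ->; rewrite !std_ptsE !co_r3 /= inordK //=; ring.
rewrite !E => /eqP; rewrite eqr_nat => e; apply: val_inj.
by move: e; case: i j => [[|[|[|[|//]]]] ?] [[|[|[|[|//]]]] ?].
Qed.

Lemma base_form_inE4 : inE4 F0 (std_pts (base_form C)).
Proof.
have mem i : std_pts (base_form C) i \in fixed_list C.
  by case: (ord4_cases i) => ->; rewrite std_ptsE !inE eqxx ?orbT.
split.
- move=> x Fx; apply/eqP; apply: contraT => x0.
  (* A common zero would count as a fixed vector of eigenvalue 0, but every vector in the list has a
     nonzero eigenvalue. *)
  have /(base_form_fixed_cases x0) [q qs [c [c0 xE]]] : qeval F0 x = 0 *: x by rewrite Fx scale0r.
  have [q0 _ [lam lam0 Fq]] := base_form_fixed_list qs.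
  move/eqP: Fx; rewrite xE qeval_scale Fq scalerA scaler_eq0 (negPf q0) orbF.
  by rewrite mulf_eq0 (negPf lam0) orbF expf_eq0 (negPf c0) andbF.
- exact: nfmx_inv_line.
- exists (fixed_list C) => p [p0 [mu Fp]].
  exact: base_form_fixed_cases p0 Fp.
- move=> p [p0 [mu Fp]]; have [q qs [c [c0 ->]]] := base_form_fixed_cases p0 Fp.
  have [q0 d0 [lam lam0 Fq]] := base_form_fixed_list qs.
  by have [_ ->] := tI_dI_scale q0 lam0 c0 Fq.
- split.
  + move=> i; rewrite co_std_pts oner_neq0; split=> //.
    by have [q0 _ [lam _ Fq]] := base_form_fixed_list (mem i); split=> //; exists lam.
  + move=> i j [c [c0 e]]; apply: std_pts_inj; rewrite e.
    have := congr1 (fun v => co v i2) e; rewrite co_scale !co_std_pts mulr1 => <-.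
    by rewrite scale1r.
  + move=> p [p0 [mu Fp]] p2; have [q qs pq] := base_form_fixed_cases p0 Fp.
    have q2 : co q i2 != 0.
      by case: pq p2 => c [_ ->]; rewrite co_scale mulf_eq0 negb_or => /andP[].
    move: qs q2 pq; rewrite !inE => /or4P[/eqP->|/eqP->|/eqP->|/or4P[/eqP->|/eqP->|/eqP->|/eqP->]].
    * by exists (inord 0); rewrite std_ptsE.
    * by exists (inord 1); rewrite std_ptsE.
    * by exists (inord 2); rewrite std_ptsE.
    * by exists (inord 3); rewrite std_ptsE.
    * by rewrite co_r3 eqxx.
    * by rewrite co_r3 eqxx.
    * by rewrite co_r3 eqxx.
Qed.

End BasePoint.

(** * Genericity *)

Section RationalFunctions.
Variables (C : numClosedFieldType) (e0 : nat -> C).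
Implicit Types f g : (nat -> C) -> C.

(* [f] is a quotient of polynomials whose denominator does not vanish at [e0]. *)
Definition regular f : Prop := exists N D : pterm C,
  peval e0 D != 0 /\ forall e, peval e D != 0 -> f e * peval e D = peval e N.

Lemma regular_var n : regular (fun e => e n).
Proof.
exists (PVar C n), (PConst 1); split; first exact: oner_neq0.
by move=> e _; rewrite /= mulr1.
Qed.

Lemma regular_const c : regular (fun _ => c).
Proof.
exists (PConst c), (PConst 1); split; first exact: oner_neq0.
by move=> e _; rewrite /= mulr1.
Qed.

Lemma regular_add f g : regular f -> regular g -> regular (fun e => f e + g e).
Proof.
move=> [N [D [D0 fE]]] [N' [D' [D0' gE]]].
exists (PAdd (PMul N D') (PMul N' D)), (PMul D D'); split; first by rewrite mulf_neq0.
move=> e /=; rewrite mulf_eq0 negb_or => /andP[/fE <- /gE <-]; ring.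
Qed.

Lemma regular_mul f g : regular f -> regular g -> regular (fun e => f e * g e).
Proof.
move=> [N [D [D0 fE]]] [N' [D' [D0' gE]]].
exists (PMul N N'), (PMul D D'); split; first by rewrite mulf_neq0.
move=> e /=; rewrite mulf_eq0 negb_or => /andP[/fE <- /gE <-]; ring.
Qed.

Lemma regular_opp f : regular f -> regular (fun e => - f e).
Proof.
move=> [N [D [D0 fE]]]; exists (POpp N), D; split=> // e /fE /= <-.
by rewrite mulNr.
Qed.

Lemma regular_exp f n : regular f -> regular (fun e => f e ^+ n).
Proof.
move=> rf; elim: n => [|n IHn]; first exact: regular_const.
have [N [D [D0 E]]] := regular_mul rf IHn.
by exists N, D; split=> // e /E; rewrite exprS.
Qed.

Lemma regular_inv f : f e0 != 0 -> regular f -> regular (fun e => (f e)^-1).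
Proof.
move=> f0 [N [D [D0 fE]]].
(* The extra factor [D] keeps the points where the equation for [f] is not asserted out of the
   domain of the inverse. *)
exists (PMul D D), (PMul N D); split; first by rewrite /= -fE // !mulf_neq0.
move=> e /=; rewrite mulf_eq0 negb_or => /andP[N0 /[dup] De /fE NE].
have fe : f e != 0 by apply: contra_neq N0 => h; rewrite -NE h mul0r.
by rewrite -NE; field.
Qed.

Lemma regular_locus f : f e0 != 0 -> regular f ->
  exists P : pterm C, peval e0 P != 0 /\ forall e, peval e P != 0 -> f e != 0.
Proof.
move=> f0 [N [D [D0 fE]]]; exists (PMul N D); split.
  by rewrite /= -fE // !mulf_neq0.
move=> e /=; rewrite mulf_eq0 negb_or => /andP[N0 /fE NE].
by apply: contra_neq N0 => h; rewrite -NE h mul0r.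
Qed.

End RationalFunctions.

Ltac regularity := repeat first
  [ assumption | apply: regular_const | apply: regular_add | apply: regular_mul
  | apply: regular_opp | apply: regular_exp | apply: regular_var | apply: regular_inv ].

(** * Regularity of the conditions at the explicit map *)

Section Genericity.
Variable C : numClosedFieldType.

Definition base_env : nat -> C := coords (nfmx (base_form C)) (std_pts (base_form C)).
Notation e0 := base_env.

Lemma nf_of_base : nf_of e0 = base_form C.
Proof.
by apply: nf_of_std; rewrite ?base_form_values //= ?oppr_eq0 pnatr_eq0.
Qed.

Lemma frame_det_base : frame_det e0 = 1.
Proof. by rewrite /frame_det !std_coords; ring. Qed.

Lemma mult_at_base : mult_at e0 3 = 1.
Proof. by rewrite /mult_at !std_coords /e0 !coordsE !nfmxE /=; ring. Qed.

Lemma regular_point i : (i < 4)%N ->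
  regular e0 (fun e => px e i) /\ regular e0 (fun e => py e i).
Proof.
move=> i4; have [_ _ E] := coords_pt (nfmx (base_form C)) (std_pts (base_form C)) i4.
by rewrite /px /py; split; regularity; rewrite /e0 E co_std_pts oner_neq0.
Qed.

Lemma regular_frame_det : regular e0 (@frame_det C).
Proof.
have [? ?] := @regular_point 0 isT; have [? ?] := @regular_point 1 isT.
have [? ?] := @regular_point 2 isT.
by rewrite /frame_det; regularity.
Qed.

Lemma regular_mult_at i : (i < 4)%N -> regular e0 (fun e => mult_at e i).
Proof. by move=> i4; have [? ?] := regular_point i4; rewrite /mult_at; regularity. Qed.

Lemma regular_coord f g : regular e0 f -> regular e0 g ->
  regular e0 (fun e => coord1 e (f e) (g e)) /\ regular e0 (fun e => coord2 e (f e) (g e)).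
Proof.
move=> rf rg; have rd := regular_frame_det.
have [? ?] := @regular_point 0 isT; have [? ?] := @regular_point 1 isT.
have [? ?] := @regular_point 2 isT.
by rewrite /coord1 /coord2; split; regularity; rewrite frame_det_base oner_neq0.
Qed.

Lemma regular_defect i j : (i < 4)%N -> (j < 4)%N ->
  regular e0 (fun e => defect_x e i j) /\ regular e0 (fun e => defect_y e i j).
Proof.
move=> i4 j4; have [? ?] := regular_point i4; have [? ?] := regular_point j4.
have ? := regular_mult_at i4; have ? := regular_mult_at j4.
by rewrite /defect_x /defect_y /polar; split; regularity.
Qed.

Lemma regular_lam : regular e0 (fun e => lam1 (nf_of e)) /\ regular e0 (fun e => lam2 (nf_of e)).
Proof.
have [? ?] := @regular_point 2 isT; have [? ?] := @regular_point 3 isT.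
by apply: regular_coord; regularity.
Qed.

Lemma base_form_neq0 : [/\ lam1 (base_form C) != 0, lam2 (base_form C) != 0 & lam3 (base_form C) != 0].
Proof. by rewrite base_form_values /= oppr_eq0 pnatr_eq0 oner_neq0. Qed.

Lemma regular_l i : (i < 4)%N -> regular e0 (fun e => e_l e i).
Proof.
move=> i4; have ? := regular_mult_at i4; have ? := @regular_mult_at 3 isT.
by rewrite /e_l; regularity; rewrite mult_at_base oner_neq0.
Qed.

Lemma regular_ab :
  [/\ regular e0 (fun e => a1 (nf_of e)), regular e0 (fun e => a2 (nf_of e)),
      regular e0 (fun e => b1 (nf_of e)) & regular e0 (fun e => b2 (nf_of e))].
Proof.
have [r1 r2] := regular_lam; have r3 := @regular_mult_at 3 isT.
have [x12 y12] := @regular_defect 1 2 isT isT; have [c1 c2] := regular_coord x12 y12.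
have [x02 y02] := @regular_defect 0 2 isT isT; have [c3 c4] := regular_coord x02 y02.
have [n1 n2 _] := base_form_neq0; rewrite -nf_of_base in n1 n2.
have m0 : mult_at e0 3 != 0 by rewrite mult_at_base oner_neq0.
rewrite /= /e_a1 /e_a2 /e_b1 /e_b2.
by split; regularity; rewrite mulf_neq0.
Qed.

Lemma regular_conditions :
  [/\ regular e0 (fun e => lam3 (nf_of e)), regular e0 (fun e => theta_sq (nf_of e)),
      regular e0 (fun e => cubD_slope (nf_of e)) & regular e0 (fun e => alt_obstruction (nf_of e))].
Proof.
have [rp rq] := regular_lam; have [ra ra' rb rb'] := regular_ab.
have rl1 : regular e0 (fun e => ev1 (nf_of e)) by exact: (@regular_l 0).
have rl2 : regular e0 (fun e => ev2 (nf_of e)) by exact: (@regular_l 1).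
have rl3 : regular e0 (fun e => ev3 (nf_of e)) by exact: (@regular_l 2).
have [p0 q0 s0] := base_form_neq0.
have one0 : (1 : C) != 0 by rewrite oner_neq0.
have l0 : [/\ ev1 (base_form C) != 0, ev2 (base_form C) != 0 & ev3 (base_form C) != 0].
  by rewrite /= oppr_eq0 oner_neq0.
have [l10 l20 l30] := l0.
have rs : regular e0 (fun e => lam3 (nf_of e)) by rewrite /lam3; regularity.
have rar : regular e0 (fun e => area (nf_of e)) by rewrite /area; regularity.
have rD1 : regular e0 (fun e => div1 (nf_of e)) by rewrite /div1; regularity.
have rD2 : regular e0 (fun e => div2 (nf_of e)) by rewrite /div2; regularity.
have rD3 : regular e0 (fun e => div3 (nf_of e)) by rewrite /div3; regularity.
have rt1 : regular e0 (fun e => mtr1 (nf_of e)) by rewrite /mtr1; regularity; rewrite nf_of_base.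
have rt2 : regular e0 (fun e => mtr2 (nf_of e)) by rewrite /mtr2; regularity; rewrite nf_of_base.
have rt3 : regular e0 (fun e => mtr3 (nf_of e)) by rewrite /mtr3; regularity; rewrite nf_of_base.
have rd1 : regular e0 (fun e => mdet1 (nf_of e)).
  by rewrite /mdet1; regularity; rewrite nf_of_base expf_neq0.
have rd2 : regular e0 (fun e => mdet2 (nf_of e)).
  by rewrite /mdet2; regularity; rewrite nf_of_base expf_neq0.
have rd3 : regular e0 (fun e => mdet3 (nf_of e)).
  by rewrite /mdet3; regularity; rewrite nf_of_base expf_neq0.
have rd4 : regular e0 (fun e => mdet4 (nf_of e)) by rewrite /mdet4; regularity.
have rh1 : regular e0 (fun e => theta1 (nf_of e)) by rewrite /theta1; regularity.
have rh2 : regular e0 (fun e => theta2 (nf_of e)) by rewrite /theta2; regularity.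
have rh3 : regular e0 (fun e => theta3 (nf_of e)) by rewrite /theta3; regularity.
have rTh : regular e0 (fun e => theta_sq (nf_of e)) by rewrite /theta_sq; regularity.
have rY : regular e0 (fun e => theta_pairing (nf_of e)) by rewrite /theta_pairing; regularity; rewrite nf_of_base.
have theta_sq0 : theta_sq (base_form C) != 0 by rewrite base_form_Th pnatr_eq0.
have rm1 : regular e0 (fun e => alt_inv_ev1 (nf_of e)) by rewrite /alt_inv_ev1; regularity; rewrite nf_of_base.
have rm2 : regular e0 (fun e => alt_inv_ev2 (nf_of e)) by rewrite /alt_inv_ev2; regularity; rewrite nf_of_base.
have rm3 : regular e0 (fun e => alt_inv_ev3 (nf_of e)) by rewrite /alt_inv_ev3; regularity; rewrite nf_of_base.
have h0 : (2%:R^-1 : C) != 0 by rewrite invr_eq0 pnatr_eq0.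
have m10 : alt_inv_ev1 (base_form C) != 0 by rewrite base_form_m.
have m20 : alt_inv_ev2 (base_form C) != 0 by rewrite base_form_m oppr_eq0.
have m30 : alt_inv_ev3 (base_form C) != 0 by rewrite base_form_m oppr_eq0.
have d10 : mdet1 (base_form C) != 0 by rewrite base_form_mult pnatr_eq0.
have d20 : mdet2 (base_form C) != 0 by rewrite base_form_mult oppr_eq0 pnatr_eq0.
have d30 : mdet3 (base_form C) != 0 by rewrite base_form_mult pnatr_eq0.
have ru1 : regular e0 (fun e => alt_lam1 (nf_of e)) by rewrite /alt_lam1; regularity; rewrite nf_of_base.
have ru2 : regular e0 (fun e => alt_lam2 (nf_of e)) by rewrite /alt_lam2; regularity; rewrite nf_of_base.
have ru3 : regular e0 (fun e => alt_lam3 (nf_of e)) by rewrite /alt_lam3; regularity; rewrite nf_of_base.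
have rf1 : regular e0 (fun e => alt_mdiv1 (nf_of e)) by rewrite /alt_mdiv1; regularity; rewrite nf_of_base.
have rf2 : regular e0 (fun e => alt_mdiv2 (nf_of e)) by rewrite /alt_mdiv2; regularity; rewrite nf_of_base.
have rf3 : regular e0 (fun e => alt_mdiv3 (nf_of e)) by rewrite /alt_mdiv3; regularity; rewrite nf_of_base.
have rsol p q s x1 x2 x3 r y z : regular e0 p -> regular e0 q -> regular e0 s ->
  regular e0 x1 -> regular e0 x2 -> regular e0 x3 -> regular e0 r ->
  regular e0 y -> regular e0 z ->
  q e0 != 0 -> p e0 + s e0 != 0 -> q e0 + s e0 != 0 ->
  regular e0 (fun e => cub_sol (p e) (q e) (s e) (x1 e) (x2 e) (x3 e) (r e) (y e) (z e)).
  by move=> *; rewrite /cub_sol /cub /sol_a1 /sol_b2 /sol_b1; regularity.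
have half_sum : (2%:R^-1 + 1 : C) != 0.
  have -> : 2%:R^-1 + 1 = 3%:R / 2%:R :> C by field.
  by rewrite mulf_neq0 ?invr_eq0 ?pnatr_eq0.
have half_diff : (- 2%:R^-1 + 1 : C) != 0.
  by have -> : - 2%:R^-1 + 1 = 2%:R^-1 :> C by field.
split=> //.
  rewrite /cubD_slope; apply: rsol; regularity; rewrite nf_of_base ?base_form_values //=.
  - by rewrite (_ : 2%:R + 1 = 3%:R) ?pnatr_eq0 //; ring.
  - by rewrite (_ : - 2%:R + 1 = -1) ?oppr_eq0 ?oner_neq0 //; ring.
have rL x1 x2 x3 r : regular e0 x1 -> regular e0 x2 -> regular e0 x3 -> regular e0 r ->
  regular e0 (fun e => alt_cubL (nf_of e) (x1 e) (x2 e) (x3 e) (r e)).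
  move=> *; rewrite /alt_cubL; apply: rsol; regularity;
  by rewrite nf_of_base ?base_form_mu ?oppr_eq0.
have rD x1 x2 x3 r : regular e0 x1 -> regular e0 x2 -> regular e0 x3 -> regular e0 r ->
  regular e0 (fun e => alt_cubD (nf_of e) (x1 e) (x2 e) (x3 e) (r e)).
  by move=> *; rewrite /alt_cubD; apply: rsol; regularity; rewrite nf_of_base !base_form_mu ?oppr_eq0.
have rR : regular e0 (fun e => ratio (nf_of e)).
  by rewrite /ratio; regularity; rewrite nf_of_base !base_form_mu mulr1 mulf_neq0 ?oppr_eq0.
have rcD : regular e0 (fun e => cubD (nf_of e)) by rewrite /cubD /cubw /cub; regularity.
have rcL : regular e0 (fun e => cubL (nf_of e)) by rewrite /cubL /cubw /cub; regularity.
have L1 : regular e0 (fun e => alt_cubL (nf_of e) 0 0 0 1) by apply: rL; regularity.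
have L2 : regular e0 (fun e => alt_cubD (nf_of e) 0 0 0 1) by apply: rD; regularity.
have L3 : regular e0 (fun e => alt_cubL (nf_of e) (- alt_mdiv1 (nf_of e)) (- alt_mdiv2 (nf_of e)) (- alt_mdiv3 (nf_of e)) 0).
  by apply: rL; regularity.
have L4 : regular e0 (fun e => alt_cubD (nf_of e) (- alt_mdiv1 (nf_of e)) (- alt_mdiv2 (nf_of e)) (- alt_mdiv3 (nf_of e)) 0).
  by apply: rD; regularity.
by rewrite /alt_obstruction; regularity.
Qed.

(** Nonvanishing of the [ev] and of [area] is absent from the list: [inE4_normal_form] draws it from
    holomorphy and from nondegeneracy at the fourth point. *)
Definition generic w : Prop :=
  [/\ [/\ lam1 w != 0, lam2 w != 0 & lam3 w != 0],
      lam1 w + lam3 w != 0 /\ lam2 w + lam3 w != 0,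
      theta_sq w != 0, cubD_slope w != 0 & alt_obstruction w != 0 :> C].

(** The conditions are multiplied into one regular function, nonzero at the explicit map; its
    numerator times its denominator is the required polynomial. *)
Lemma generic_locus : exists P : pterm C, peval e0 P != 0 /\
  forall e, peval e P != 0 -> frame_det e != 0 /\ generic (nf_of e).
Proof.
have [rp rq] := regular_lam; have [rs rT rS rP] := regular_conditions.
have rd := regular_frame_det.
pose f (e : nat -> C) := frame_det e * (lam1 (nf_of e) * lam2 (nf_of e) * lam3 (nf_of e))
  * ((lam1 (nf_of e) + lam3 (nf_of e)) * (lam2 (nf_of e) + lam3 (nf_of e)))
  * (theta_sq (nf_of e) * cubD_slope (nf_of e) * alt_obstruction (nf_of e)).
have rf : regular e0 f by rewrite /f; regularity.
have f0 : f e0 != 0.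
  have [k1 k2 k3] := base_form_neq0; rewrite /f frame_det_base nf_of_base mul1r.
  have k13 : lam1 (base_form C) + lam3 (base_form C) != 0.
    by rewrite base_form_values /= (_ : 2%:R + 1 = 3%:R) ?pnatr_eq0 //; ring.
  have k23 : lam2 (base_form C) + lam3 (base_form C) != 0.
    by rewrite base_form_values /= (_ : - 2%:R + 1 = -1) ?oppr_eq0 ?oner_neq0 //; ring.
  have kT : theta_sq (base_form C) != 0 by rewrite base_form_Th pnatr_eq0.
  have kS : cubD_slope (base_form C) != 0 by rewrite base_form_cubD_slope oppr_eq0 pnatr_eq0.
  have kP : alt_obstruction (base_form C) != 0 by rewrite base_form_Psi oppr_eq0 mulf_neq0 ?pnatr_eq0.
  by rewrite !mulf_neq0.
have [P [P0 PE]] := regular_locus f0 rf; exists P; split=> // e /PE.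
rewrite /f; move: (nf_of e) (frame_det e) => w d; rewrite !mulf_eq0 !negb_or.
by move=> /andP[/andP[/andP[? /andP[/andP[? ?] ?]] /andP[? ?]] /andP[/andP[? ?] ?]].
Qed.

End Genericity.

(** * From marked maps to equal normal forms *)

Section Main.
Variable C : numClosedFieldType.

Lemma inE4_normal_form (F : 'M[C]_(3, 6)) (ps : 'I_4 -> 'rV[C]_3) (e := coords F ps) :
  inE4 F ps -> frame_det e != 0 -> generic (nf_of e) ->
  [/\ conjugates (mult_at e 3) (frame e) F (nfmx (nf_of e)),
      nondegenerate (nf_of e), area (nf_of e) != 0
    & forall i, same_point (std_pts (nf_of e) i *m frame e) (ps i)].
Proof.
move=> [hF Fl _ dF [fix4 _ _]] det0 [[p0 q0 s0] [ps0 qs0] _ _ _].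
have n0 i : (i < 4)%N -> mult_at e i != 0.
  move=> i4; have [fp p2] := fix4 (inord i).
  exact: holo_eigen_neq0 hF (affine_neq0 _ _) (npt_eigen Fl i4 fp p2).
have conj := reduction Fl fix4 det0 p0 q0 (n0 3 isT).
have l0 i : (i < 4)%N -> e_l e i != 0.
  by move=> i4; rewrite /e_l mulf_neq0 ?invr_eq0 ?n0.
have nd : nondegenerate (nf_of e).
  by split=> //; [split; exact: l0 | apply: l4_nf_of; rewrite ?n0].
have [pE1 pE2 pE3] := frame_pt e; have pE4 := frame_pt4 det0.
have sp (i : 'I_4) : same_point (std_pts (nf_of e) i *m frame e) (ps i).
  have key k : (k < 4)%N -> same_point (npt e k) (ps (inord k)).
    move=> k4; have [_ p2] := fix4 (inord k); exists (co (ps (inord k)) i2)^-1.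
    by rewrite invr_eq0 p2 [X in _ *: X](ps_npt F k4 p2) scalerA mulVf ?scale1r.
  case: (ord4_cases i) => ->; rewrite std_ptsE ?pE1 ?pE2 ?pE3 ?pE4; exact: key.
split=> //.
have [_ _ _ _ l41] := nd; have [_ dE] := nfmx_pt4_mult l41.
have fx : is_fixed (nfmx (nf_of e)) (pt4 (nf_of e)).
  by split; [exact: affine_neq0 | exists (ev4 (nf_of e)); exact: nfmx_pt4].
have [_ dE'] := conjugates_tI_dI conj hF fx.
(* [area] is a factor of the determinant at the fourth marked point, which is nonzero by
   nondegeneracy. *)
have := dF _ (conjugates_fixed conj fx); rewrite dE' dE /mdet4.
by rewrite mulf_eq0 negb_or => /andP[].
Qed.

Lemma nfmx_std_fixed (w : nform C) i : is_fixed (nfmx w) (std_pts w i).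
Proof.
case: (ord4_cases i) => ->; rewrite std_ptsE; split; try exact: affine_neq0.
- by exists (ev1 w); exact: nfmx_pt1.
- by exists (ev2 w); exact: nfmx_pt2.
- by exists (ev3 w); exact: nfmx_pt3.
- by exists (ev4 w); exact: nfmx_pt4.
Qed.

Lemma tI_dI_same_point (F : 'M[C]_(3, 6)) p q : holo F -> is_fixed F q ->
  same_point p q -> tI F p = tI F q /\ dI F p = dI F q.
Proof.
move=> hF [q0 [lam Fq]] [c [c0 ->]].
exact: tI_dI_scale q0 (holo_eigen_neq0 hF q0 Fq) c0 Fq.
Qed.

Lemma normal_form_mults (F : 'M[C]_(3, 6)) c A w p i : conjugates c A F (nfmx w) -> holo F ->
  is_fixed F p -> same_point (std_pts w i *m A) p ->
  tI F p = tI (nfmx w) (std_pts w i) /\ dI F p = dI (nfmx w) (std_pts w i).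
Proof.
move=> conj hF fp sp; have [<- <-] := conjugates_tI_dI conj hF (nfmx_std_fixed w i).
by have [<- <-] := tI_dI_same_point hF fp sp.
Qed.

Lemma same_line_mults_conj (F G : 'M[C]_(3, 6)) c c' A A' w w' :
  holo F -> inv_line F -> holo G -> inv_line G ->
  conjugates c A F (nfmx w) -> preserves_line A ->
  conjugates c' A' G (nfmx w') -> preserves_line A' ->
  same_line_mults F G -> same_line_mults (nfmx w) (nfmx w').
Proof.
move=> hF Fl hG Gl cF pA cG pA' [a [b [fa fb uv]]].
have ea := conjugates_line_enum cF pA fa; have eb := conjugates_line_enum cG pA' fb.
exists (fun j => a j *m invmx A), (fun j => b j *m invmx A'); split=> // j.
have [/(_ j) [fj fj2] _ _] := ea; have [/(_ j) [gj gj2] _ _] := eb.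
have [uE vE] := conjugates_uI_vI cF pA hF Fl fj fj2.
have [uE' vE'] := conjugates_uI_vI cG pA' hG Gl gj gj2.
have [_ uA _] := cF; have [_ uA' _] := cG.
rewrite !mulmxKV // in uE vE uE' vE'.
by rewrite -uE -vE -uE' -vE'; exact: uv.
Qed.

Lemma nondegenerate_mults (w : nform C) : nondegenerate w ->
  [/\ tI (nfmx w) (pt1 C) = mtr1 w /\ dI (nfmx w) (pt1 C) = mdet1 w,
      tI (nfmx w) (pt2 C) = mtr2 w /\ dI (nfmx w) (pt2 C) = mdet2 w,
      tI (nfmx w) (pt3 C) = mtr3 w /\ dI (nfmx w) (pt3 C) = mdet3 w
    & tI (nfmx w) (pt4 w) = mtr4 w /\ dI (nfmx w) (pt4 w) = mdet4 w].
Proof.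
move=> [_ _ _ [k1 k2 k3] k4]; split.
- exact: nfmx_pt1_mult.
- exact: nfmx_pt2_mult.
- exact: nfmx_pt3_mult.
- exact: nfmx_pt4_mult.
Qed.

Lemma conjugates_dI (F : 'M[C]_(3, 6)) c A G : conjugates c A F G -> holo F ->
  (forall p, is_fixed F p -> dI F p != 0) -> forall p, is_fixed G p -> dI G p != 0.
Proof.
move=> conj hF dF p fp; have [_ <-] := conjugates_tI_dI conj hF fp.
exact: dF (conjugates_fixed conj fp).
Qed.

End Main.

Theorem theorem2 (C : numClosedFieldType) :
  exists P : pterm C,
    (exists (Fc : 'M[C]_(3, 6)) (ps : 'I_4 -> 'rV[C]_3),
        inE4 Fc ps /\ peval (coords Fc ps) P != 0) /\
    forall (Fc Gc : 'M[C]_(3, 6)) (ps qs : 'I_4 -> 'rV[C]_3),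
      inE4 Fc ps -> peval (coords Fc ps) P != 0 ->
      inE4 Gc qs -> peval (coords Gc qs) P != 0 ->
      (forall i, tI Fc (ps i) = tI Gc (qs i) /\ dI Fc (ps i) = dI Gc (qs i)) ->
      same_line_mults Fc Gc ->
      exists A : 'M[C]_3,
        [/\ in_Aut_l A,
            forall x : 'rV[C]_3, x != 0 ->
              same_point (qeval Gc (x *m A)) (qeval Fc x *m A) &
            forall i, same_point (ps i *m A) (qs i)].
Proof.
have [P [P0 PE]] := generic_locus C; exists P; split.
  by exists (nfmx (base_form C)), (std_pts (base_form C)); split=> //; exact: base_form_inE4.
move=> F G ps qs EF /PE [detF gF] EG /PE [detG gG] mults line.
have [cF nF arF sF] := inE4_normal_form EF detF gF.
have [cG nG arG sG] := inE4_normal_form EG detG gG.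
have [hF Fl _ dF [fixF _ _]] := EF; have [hG Gl _ dG [fixG _ _]] := EG.
have pA := frame_preserves_line (coords F ps); have pB := frame_preserves_line (coords G qs).
move: gF cF nF arF sF gG cG nG arG sG pA pB.
set c := mult_at _ _; set A := frame _; set w := nf_of _.
set d := mult_at _ _; set B := frame _; set w' := nf_of _.
move=> [_ _ theta_sq0 slope0 Psi0] cF nF arF sF _ cG nG arG sG pA pB.
have mE i : tI (nfmx w') (std_pts w' i) = tI (nfmx w) (std_pts w i) /\
            dI (nfmx w') (std_pts w' i) = dI (nfmx w) (std_pts w i).
  have [tF dF'] := normal_form_mults cF hF (fixF i).1 (sF i).
  have [tG dG'] := normal_form_mults cG hG (fixG i).1 (sG i).
  by have [te de] := mults i; rewrite -tG -dG' -tF -dF' te de.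
have [wE1 wE2 wE3 wE4] := nondegenerate_mults nF; have [n1 n2 n3 n4] := nondegenerate_mults nG.
have E1 := mE (inord 0); have E2 := mE (inord 1); have E3 := mE (inord 2); have E4 := mE (inord 3).
rewrite !std_ptsE ?wE1.1 ?wE1.2 ?n1.1 ?n1.2 in E1; rewrite !std_ptsE ?wE2.1 ?wE2.2 ?n2.1 ?n2.2 in E2.
rewrite !std_ptsE ?wE3.1 ?wE3.2 ?n3.1 ?n3.2 in E3; rewrite !std_ptsE ?wE4.1 ?wE4.2 ?n4.1 ?n4.2 in E4.
have [rho [r1 r2 r3]] := same_line_mults_invariants
  (conjugates_holo cF hF) (conjugates_holo cG hG) (conjugates_dI cF hF dF) (conjugates_dI cG hG dG)
  (same_line_mults_conj hF Fl hG Gl cF pA cG pB line).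
have ww' : w = w'.
  have [[t1E d1E] [t2E d2E]] := (E1, E2); have [[t3E d3E] [t4E d4E]] := (E3, E4).
  exact: nform_rigidity r1 r2 r3.
have [c0 uA FA] := cF; have [d0 uB GB] := cG.
(* Both maps have the same normal form: the automorphism leaves the frame of the first map and
   enters that of the second. *)
exists (invmx A *m B); split.
- apply: preserves_line_in_Aut; first by rewrite unitmx_mul unitmx_inv uA.
  exact: preserves_line_mul (preserves_line_inv uA pA) pB.
- move=> x _; exists (d / c); split; first by rewrite mulf_neq0 ?invr_eq0.
  have -> : qeval F x = c *: (qeval (nfmx w) (x *m invmx A) *m A) by rewrite -FA mulmxKV.
  by rewrite mulmxA GB -ww' -scalemxAl scalerA divfK // mulmxA mulmxK.
- move=> i; have [k [k0 kE]] := sF i; have [k' [k'0 k'E]] := sG i.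
  exists (k' / k); split; first by rewrite mulf_neq0 ?invr_eq0.
  have -> : ps i = k^-1 *: (std_pts w i *m A) by rewrite kE scalerA mulVf ?scale1r.
  by rewrite -!scalemxAl mulmxA mulmxK // ww' k'E scalerA mulrC.
Qed.
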